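(* Let $\Sigma$ be an orientable, complete, non-compact surface embedded in $\mathbb{R}^3$, not totally geodesic, whose second fundamental form goes to zero at infinity. Let $a>0$ be such that $\tilde p(x,t)=p(x)+t\vec N_x$ is an embedding of $\Sigma\times[-a,a]$ into $\mathbb{R}^3$, and let $\Omega=\Sigma\times[-a,a]$ be the quantum layer over $\Sigma$. Let $\sigma_{ess}$ be the infimum of the essential spectrum of the Dirichlet Laplacian of $\Omega$. Then $$\sigma_{ess}\ge\frac{\pi^2}{4a^2}.$$
   Context: All surfaces are smooth. Let $p:\Sigma\to\mathbb{R}^3$ be the embedding and $\vec N$ a unit normal vector field of $\Sigma$. The second fundamental form $B$ goes to zero at infinity if for every $\varepsilon>0$ there is a compact subset of $\Sigma$ outside of which $\|B\|<\varepsilon$. The quantum layer is the manifold with boundary $\Omega=\Sigma\times[-a,a]$ with the Riemannian metric $ds^2_\Omega$ obtained by pulling back the Euclidean metric via $\tilde p$. The Dirichlet Laplacian of $\Omega$ (with the sign convention making it nonnegative) is the self-adjoint (Friedrichs) extension of the Laplacian acting on smooth functions compactly supported in the interior of $\Omega$. The infimum of its essential spectrum is given by $$\sigma_{ess}=\sup_{K}\ \inf_{f}\ \frac{\int_\Omega|\nabla f|^2\,d\Omega}{\int_\Omega f^2\,d\Omega},$$ where $K$ runs over all compact subsets of $\Omega$ and $f$ runs over all nonzero smooth functions with compact support in the interior of $\Omega$ minus $K$. Equivalently, $K$ may be taken to run over sets of the form $K'\times[-a,a]$ with $K'\subset\Sigma$ compact. *)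

(* Defs.v *)
From HB Require Import structures.
From mathcomp Require Import all_boot all_order all_algebra.
From mathcomp Require Import all_classical all_reals all_analysis.
Set Implicit Arguments.
Unset Strict Implicit.
Unset Printing Implicit Defensive.
Import Order.TTheory GRing.Theory Num.Theory numFieldNormedType.Exports.
Local Open Scope classical_set_scope.
Local Open Scope ring_scope.

(* An embedded surface is identified with its image S in R^3, an embedded
   submanifold carrying the subspace topology. Parameter domains of the surface
   are open subsets of R * R, those of the layer are subsets of (R * R) * R. *)

Section Calculus.
Variable R : realType.

Definition iter_derive (V W : normedModType R) (f : V -> W) (s : seq V) :
    V -> W :=
  foldr (fun v g x => 'D_v g x) f s.

(* For V finite-dimensional and A open this is C^infty on A: all iterated
   directional derivatives exist and are continuous at every point of A. *)
Definition smooth_on (V W : normedModType R) (A : set V) (f : V -> W) : Prop :=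
  forall (s : seq V) (x : V), A x ->
    {for x, continuous (iter_derive f s)} /\
    (forall v : V, derivable (iter_derive f s) x v).

(* The norm of the library on 'rV_3 is the sup norm, hence these. *)
Definition dot (u v : 'rV[R]_3) : R := (u *m v^T) 0 0.
Definition enorm (u : 'rV[R]_3) : R := Num.sqrt (dot u u).

Definition basis2 (i : 'I_2) : R * R :=
  ((i == 0 :> nat)%:R, (i == 1 :> nat)%:R).
Definition basis3 (i : 'I_3) : R * R * R :=
  ((i == 0 :> nat)%:R, (i == 1 :> nat)%:R, (i == 2 :> nat)%:R).

(* Row i is the i-th partial derivative. *)
Definition jac2 (phi : R * R -> 'rV[R]_3) (u : R * R) : 'M[R]_(2, 3) :=
  \matrix_(i < 2, j < 3) ('D_(basis2 i) phi u) 0 j.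
Definition jac3 (Phi : R * R * R -> 'rV[R]_3) (q : R * R * R) : 'M[R]_3 :=
  \matrix_(i < 3, j < 3) ('D_(basis3 i) Phi q) 0 j.

Definition lebesgue3 : set (measurableTypeR R * measurableTypeR R
                            * measurableTypeR R) -> \bar R :=
  ((@lebesgue_measure R \x @lebesgue_measure R) \x @lebesgue_measure R)%E.

End Calculus.

Arguments basis2 {R} i.
Arguments basis3 {R} i.

Section Surface.
Variable R : realType.
Implicit Types (S : set 'rV[R]_3) (N : 'rV[R]_3 -> 'rV[R]_3).
Implicit Types (U : set (R * R)) (phi : R * R -> 'rV[R]_3).

(* The last clause says that phi is a homeomorphism from U onto a relatively
   open subset of S. *)
Definition local_param S U phi : Prop :=
  [/\ open U,
      smooth_on U phi,
      forall u, U u -> row_free (jac2 phi u),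
      {in U &, injective phi} &
      forall W, open W -> W `<=` U ->
        exists2 V : set 'rV[R]_3, open V & phi @` W = S `&` V].

Definition embedded_surface S : Prop :=
  forall x, S x -> exists U phi, local_param S U phi /\ (phi @` U) x.

Definition orientable S : Prop :=
  exists Atlas : set (set (R * R) * (R * R -> 'rV[R]_3)),
    [/\ forall c, Atlas c -> local_param S c.1 c.2,
        forall x, S x -> exists2 c, Atlas c & (c.2 @` c.1) x &
        forall c c' u u', Atlas c -> Atlas c' -> c.1 u -> c'.1 u' ->
          c.2 u = c'.2 u' ->
          exists2 M : 'M[R]_2, 0 < \det M & jac2 c.2 u = M *m jac2 c'.2 u'].

(* Piecewise smooth curves are finite concatenations of smooth arcs, each
   parametrized by [0, 1] (and extending smoothly to a neighbourhood in R^3,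
   equivalently to R). *)
Definition smooth_arc S (c : R -> 'rV[R]_3) : Prop :=
  smooth_on setT c /\ (forall t, 0 <= t <= 1 -> S (c t)).

Definition arc_length (c : R -> 'rV[R]_3) : \bar R :=
  (\int[@lebesgue_measure R]_(t in `[0%R, 1%R]) (enorm ('D_1 c t))%:E)%E.

Inductive joined S : 'rV[R]_3 -> 'rV[R]_3 -> \bar R -> Prop :=
| joined_refl x : S x -> joined S x x 0%E
| joined_arc x l c : joined S x (c 0) l -> smooth_arc S c ->
    joined S x (c 1) (l + arc_length c)%E.

(* +oo when x and y lie in different components of S *)
Definition surface_dist S (x y : 'rV[R]_3) : \bar R :=
  ereal_inf [set l | joined S x y l].

Definition complete_surface S : Prop :=
  forall s : nat -> 'rV[R]_3, (forall n, S (s n)) ->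
    (forall e : R, 0 < e -> exists n0, forall m n,
       (n0 <= m)%N -> (n0 <= n)%N -> (surface_dist S (s m) (s n) < e%:E)%E) ->
    exists2 x, S x & forall e : R, 0 < e -> exists n0, forall n,
       (n0 <= n)%N -> (surface_dist S (s n) x < e%:E)%E.

Definition unit_normal_field S N : Prop :=
  forall U phi, local_param S U phi ->
    smooth_on U (N \o phi) /\
    (forall u, U u ->
       enorm (N (phi u)) = 1 /\ jac2 phi u *m (N (phi u))^T = 0).

Definition first_form phi (u : R * R) : 'M[R]_2 :=
  jac2 phi u *m (jac2 phi u)^T.

Definition second_form N phi (u : R * R) : 'M[R]_2 :=
  \matrix_(i < 2, j < 2)
    dot ('D_(basis2 i) (fun v => 'D_(basis2 j) phi v) u) (N (phi u)).

(* |B|^2 = g^ik g^jl B_ij B_kl, the squared norm of B as a tensor, that is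
   k1^2 + k2^2 for the principal curvatures k1 and k2 *)
Definition second_form_norm N phi (u : R * R) : R :=
  let A := invmx (first_form phi u) *m second_form N phi u in
  Num.sqrt (\tr (A *m A)).

Definition totally_geodesic S N : Prop :=
  forall U phi, local_param S U phi ->
    forall u, U u -> second_form N phi u = 0.

Definition second_form_vanishes_at_infinity S N : Prop :=
  forall e : R, 0 < e ->
    exists C : set 'rV[R]_3, [/\ compact C, C `<=` S &
      forall U phi, local_param S U phi ->
        forall u, U u -> ~ C (phi u) -> second_form_norm N phi u < e].

End Surface.

Section Layer.
Variable R : realType.
Implicit Types (S : set 'rV[R]_3) (N : 'rV[R]_3 -> 'rV[R]_3) (a : R).
Implicit Types (U : set (R * R)) (phi : R * R -> 'rV[R]_3).

Definition layer S a : set ('rV[R]_3 * R) := S `*` `[- a, a].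
Definition layer_interior S a : set ('rV[R]_3 * R) := S `*` `]- a, a[.

Definition layer_map N (z : 'rV[R]_3 * R) : 'rV[R]_3 := z.1 + z.2 *: N z.1.

(* The parametrization of the layer induced by a parametrization of the
   surface, and its composite with the layer map. *)
Definition layer_chart phi (q : R * R * R) : 'rV[R]_3 * R := (phi q.1, q.2).
Definition layer_coord N phi (q : R * R * R) : 'rV[R]_3 :=
  layer_map N (layer_chart phi q).

Definition chart_domain U a : set (R * R * R) := U `*` `[- a, a].

(* Injective immersion which is a homeomorphism onto its image; smoothness is
   automatic. *)
Definition layer_embedding S N a : Prop :=
  [/\ {in layer S a &, injective (layer_map N)},
      forall U phi, local_param S U phi ->
        forall q, chart_domain U a q -> jac3 (layer_coord N phi) q \in unitmx &
      forall W : set ('rV[R]_3 * R), open W ->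
        exists2 V : set 'rV[R]_3, open V &
          layer_map N @` (W `&` layer S a) = V `&` layer_map N @` layer S a].

(* The metric of the layer in the coordinates (u, v, t): the Euclidean metric
   pulled back by the layer map. *)
Definition layer_metric N phi (q : R * R * R) : 'M[R]_3 :=
  jac3 (layer_coord N phi) q *m (jac3 (layer_coord N phi) q)^T.

(* The Riemannian measure of the layer, a Borel measure: in coordinates it has
   density sqrt (det g). This determines it on the Borel subsets of the layer,
   which is covered by countably many charts. *)
Definition layer_volume S N a
    (mu : {measure set (g_sigma_algebraType (@open ('rV[R]_3 * R)%type))
           -> \bar R}) : Prop :=
  forall U phi, local_param S U phi ->
    forall E : set (g_sigma_algebraType (@open ('rV[R]_3 * R)%type)),
      measurable E -> E `<=` layer_chart phi @` chart_domain U a ->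
      mu E = (\int[@lebesgue3 R]_(q in chart_domain U a
                                      `&` layer_chart phi @^-1` E)
               (Num.sqrt (\det (layer_metric N phi q)))%:E)%E.

Definition layer_diff phi (f : 'rV[R]_3 * R -> R) (q : R * R * R) : 'rV[R]_3 :=
  \row_(i < 3) 'D_(basis3 i) (f \o layer_chart phi) q.

(* |grad f|^2 = g^ij d_i f d_j f, computed in an arbitrary chart around z (the
   value does not depend on the chart) *)
Definition grad_normsq S N (f : 'rV[R]_3 * R -> R) (z : 'rV[R]_3 * R) : R :=
  xget 0 [set r | exists U phi q,
    [/\ local_param S U phi, U q.1, layer_chart phi q = z &
        r = (layer_diff phi f q *m invmx (layer_metric N phi q)
             *m (layer_diff phi f q)^T) 0 0]].

(* f is extended by 0 outside the layer *)
Definition test_function S a (K : set ('rV[R]_3 * R)) (f : 'rV[R]_3 * R -> R) :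
    Prop :=
  [/\ forall U phi, local_param S U phi ->
        smooth_on (U `*` `]- a, a[) (f \o layer_chart phi),
      compact (closure [set z | f z != 0]),
      closure [set z | f z != 0] `<=` layer_interior S a `\` K &
      exists z, f z != 0].

Definition rayleigh S N a
    (mu : {measure set (g_sigma_algebraType (@open ('rV[R]_3 * R)%type))
           -> \bar R}) (f : 'rV[R]_3 * R -> R) : \bar R :=
  ((\int[mu]_(z in layer S a) (grad_normsq S N f z)%:E)
   / (\int[mu]_(z in layer S a) (f z ^+ 2)%:E))%E.

(* Infimum of the essential spectrum of the Dirichlet Laplacian, given by the
   variational (Persson) formula. *)
Definition sigma_ess S N a
    (mu : {measure set (g_sigma_algebraType (@open ('rV[R]_3 * R)%type))
           -> \bar R}) : \bar R :=
  ereal_sup [set ereal_inf [set rayleigh S N a mu f | f in test_function S a K]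
            | K in [set K | compact K /\ K `<=` layer S a]].

End Layer.

(* Main.v *)
(* The gradient dominates the derivative along the fibres of the layer: the last
   row of the Jacobian of the layer map is the unit vector N, so |df/dt| <= |grad f|
   by Cauchy-Schwarz.  The volume density is 1 - t H + t^2 G times that of the
   surface, where H and G are the trace and the determinant of the shape operator;
   these are controlled by |B| because the shape operator is diagonalizable (this
   is where the symmetry of the second fundamental form enters).  Hence outside a
   compact set the density is, up to factors 1 - d and 1 + d, independent of t,
   and the Dirichlet inequality on (-a, a), whose first eigenvalue is
   (pi / (2 a))^2, can be integrated over the surface. *)

Require Import Defs.
From HB Require Import structures.
From mathcomp Require Import all_boot all_order all_algebra.
From mathcomp Require Import all_classical all_reals all_analysis.
From mathcomp Require Import measurable_realfun.
From mathcomp Require Import ring lra.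
Set Implicit Arguments.
Unset Strict Implicit.
Unset Printing Implicit Defensive.
Import Order.TTheory GRing.Theory Num.Theory numFieldNormedType.Exports.
Local Open Scope classical_set_scope.
Local Open Scope ring_scope.

(** * Linear algebra *)

Lemma dotE (R : realType) (u v : 'rV[R]_3) : dot u v = \sum_(i < 3) u 0 i * v 0 i.
Proof. by rewrite /dot mxE; apply: eq_bigr => i _; rewrite mxE. Qed.

Lemma dotC (R : realType) (u v : 'rV[R]_3) : dot u v = dot v u.
Proof. by rewrite !dotE; apply: eq_bigr => i _; rewrite mulrC. Qed.

Lemma dot_ge0 (R : realType) (u : 'rV[R]_3) : 0 <= dot u u.
Proof. by rewrite dotE; apply: sumr_ge0 => i _; rewrite -expr2 sqr_ge0. Qed.

Lemma enorm_eq1 (R : realType) (u : 'rV[R]_3) : enorm u = 1 -> dot u u = 1.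
Proof. by move=> u1; rewrite -[LHS](sqr_sqrtr (dot_ge0 u)) -/(enorm u) u1 expr1n. Qed.

Lemma sqr_dot_le (R : realType) (u n : 'rV[R]_3) :
  dot n n = 1 -> dot u n ^+ 2 <= dot u u.
Proof.
move=> n1.
rewrite -subr_ge0.
have -> : dot u u - dot u n ^+ 2 = dot (u - dot u n *: n) (u - dot u n *: n).
  have [c cE] : exists c, dot u n = c by exists (dot u n).
  rewrite cE; move: n1 cE; rewrite !dotE !big_ord_recr !big_ord0 /= !mxE !add0r.
  set x := u _ _; set y := u _ _; set z := u _ _.
  set x' := n _ _; set y' := n _ _; set z' := n _ _ => n1 cE.
  have -> : (x - c * x') * (x - c * x') + (y - c * y') * (y - c * y') +
     (z - c * z') * (z - c * z') = x * x + y * y + z * z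
    - 2 * c * (x * x' + y * y' + z * z')
    + c ^+ 2 * (x' * x' + y' * y' + z' * z') by ring.
  by rewrite n1 -cE; ring.
exact: dot_ge0.
Qed.

Lemma pullback_metric_ge (R : realType) (J : 'M[R]_3) (v : 'rV[R]_3) :
  J \in unitmx -> dot (row 2 J) (row 2 J) = 1 ->
  v 0 2 ^+ 2 <= (v *m invmx (J *m J^T) *m v^T) 0 0.
Proof.
move=> Ju J1.
have JTu : J^T \in unitmx by rewrite unitmx_tr.
pose y := v *m invmx J^T.
have -> : (v *m invmx (J *m J^T) *m v^T) 0 0 = dot y y.
  rewrite /dot /y trmx_mul trmx_inv trmxK !mulmxA.
  congr (fun_of_matrix (_ *m _) _ _); rewrite -!mulmxA; congr (_ *m _).
  have JJu : J *m J^T \in unitmx by rewrite unitmx_mul Ju JTu.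
  apply: (can_inj (mulKmx JJu)).
  by rewrite mulmxV// -mulmxA (mulmxA J^T) mulmxV// mul1mx mulmxV.
have -> : v 0 2 = dot y (row 2 J).
  have -> : v = y *m J^T by rewrite /y mulmxKV.
  by rewrite /dot [LHS]mxE [RHS]mxE; apply: eq_bigr => i _; rewrite !mxE.
exact: sqr_dot_le.
Qed.

Lemma trace_disc_ge0 (R : realType) (E F G p q r s : R) :
  0 <= E -> 0 <= G -> 0 < E * G - F ^+ 2 ->
  E * q + F * s = F * p + G * r ->
  0 <= (p - s) ^+ 2 + 4 * q * r.
Proof.
move=> E0 G0 D sym.
have E_gt0 : 0 < E.
  rewrite lt_neqAle E0 andbT; apply/eqP => E00.
  by move: D; rewrite -E00 mul0r sub0r oppr_gt0 ltNge sqr_ge0.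
rewrite -(@pmulr_rge0 _ E)// -(@pmulr_rge0 _ E)//.
have -> : E * (E * ((p - s) ^+ 2 + 4 * q * r)) =
   (E * (p - s) + 2 * F * r) ^+ 2 + 4 * (E * G - F ^+ 2) * r ^+ 2.
  have -> : E * (E * ((p - s) ^+ 2 + 4 * q * r)) =
     E ^+ 2 * (p - s) ^+ 2 + 4 * E * r * (E * q + F * s) - 4 * E * r * F * s by ring.
  by rewrite sym; ring.
by rewrite addr_ge0 ?sqr_ge0// mulr_ge0 ?sqr_ge0// mulr_ge0// ltW.
Qed.

Lemma trace_det_bounds (R : realType) (p q r s e : R) :
  0 <= e -> 0 <= (p - s) ^+ 2 + 4 * q * r ->
  p ^+ 2 + 2 * q * r + s ^+ 2 <= e ^+ 2 ->
  `|p + s| <= 2 * e /\ `|p * s - q * r| <= e ^+ 2.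
Proof.
move=> e0 disc le_e.
have T2 : (p + s) ^+ 2 <= (2 * e) ^+ 2.
  have -> : (p + s) ^+ 2 = 2 * (p ^+ 2 + 2 * q * r + s ^+ 2) -
    ((p - s) ^+ 2 + 4 * q * r) by ring.
  have : 0 <= e ^+ 2 by exact: sqr_ge0.
  rewrite exprMn; lra.
split.
  by rewrite -(@ler_pXn2r _ 2)// ?nnegrE ?mulr_ge0// real_normK// num_real.
have := sqr_ge0 (p + s).
by move=> h; rewrite ler_norml; apply/andP; split; nra.
Qed.

(* [det (I - t II) = det I * (1 - t tr A + t^2 det A)] with [A = I^-1 II]. *)
Lemma det_shape_pencil (R : realType) (E F G L M N p q r s t : R) :
  E * p + F * r = L -> E * q + F * s = M -> F * p + G * r = M ->
  F * q + G * s = N ->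
  (E - t * L) * (G - t * N) - (F - t * M) ^+ 2 =
  (E * G - F ^+ 2) * (1 - t * (p + s) + t ^+ 2 * (p * s - q * r)).
Proof.
move=> eL eM eM' eN.
have -> : (F - t * M) ^+ 2 = (F - t * M) * (F - t * M) by rewrite expr2.
rewrite -[X in _ - X * _]/(F - t * M) -{1}eM -eM' -eL -eN; ring.
Qed.

(** * Calculus *)

Section derive_along.
Context {R : realType} {V W Z : normedModType R}.
Variables (F : V -> W) (L : Z -> V) (a v : Z) (w : V).
Hypothesis Lw : forall h : R, L (h *: v + a) = h *: w + L a.

Let slopeE : (fun h : R => h^-1 *: (((F \o L) \o shift a) (h *: v) - (F \o L) a))
  = (fun h : R => h^-1 *: ((F \o shift (L a)) (h *: w) - F (L a))).
Proof. by apply/funext => h /=; rewrite Lw. Qed.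

Lemma derive_along : 'D_v (F \o L) a = 'D_w F (L a).
Proof. by rewrite /derive slopeE. Qed.

Lemma derivable_along : derivable (F \o L) a v <-> derivable F (L a) w.
Proof. by rewrite /derivable slopeE. Qed.

End derive_along.

Section mixed_derivatives.
Context {R : realType} {V : normedModType R}.
Implicit Types (f : V -> R) (x v w : V).

Let line_shift v (y : V) (s h : R) :
  (fun s : R => s *: v + y) (h *: (1 : R) + s) =
  h *: v + (fun s : R => s *: v + y) s.
Proof. by rewrite /= scalerDl addrA; congr (_ *: _ + _ + _); exact: mulr1. Qed.

Lemma is_derive_line f (y v : V) (s : R) : derivable f (s *: v + y) v ->
  is_derive s 1 (fun s : R => f (s *: v + y)) ('D_v f (s *: v + y)).
Proof.
move=> fv; apply: DeriveDef.
  exact/(derivable_along f (line_shift v y s)).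
exact: (derive_along f (line_shift v y s)).
Qed.

Lemma second_difference f x v w (h : R) : 0 < h ->
  (forall s t, 0 <= s <= h -> 0 <= t <= h ->
    derivable f (s *: v + (t *: w + x)) v) ->
  (forall s t, 0 <= s <= h -> 0 <= t <= h ->
    derivable ('D_v f) (t *: w + (s *: v + x)) w) ->
  exists s t, [/\ 0 <= s <= h, 0 <= t <= h &
    f (h *: v + (h *: w + x)) - f (h *: v + x) - (f (h *: w + x) - f x) =
    'D_w ('D_v f) (t *: w + (s *: v + x)) * h * h].
Proof.
move=> h0 fv fvw.
pose p (s : R) := f (s *: v + (h *: w + x)) - f (s *: v + x).
have pd s : 0 <= s <= h ->
    is_derive s 1 p ('D_v f (s *: v + (h *: w + x)) - 'D_v f (s *: v + x)).
  move=> sh; apply: is_deriveB; apply: is_derive_line.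
    by apply: fv => //; rewrite lexx ltW.
  by rewrite -[x]add0r -(scale0r w); apply: fv => //; rewrite lexx ltW.
have [||s sI] := @MVT_segment R p
   (fun s => 'D_v f (s *: v + (h *: w + x)) - 'D_v f (s *: v + x)) 0 h (ltW h0).
- by move=> s; rewrite in_itv /= => /andP[s0 sh]; apply: pd; rewrite !ltW.
- apply: derivable_within_continuous => s; rewrite in_itv /= => sI.
  by have [] := pd s sI.
rewrite subr0 {1 2}/p !scale0r !add0r => ->.
rewrite in_itv /= in sI.
pose q (t : R) := 'D_v f (t *: w + (s *: v + x)).
have qd t : 0 <= t <= h -> is_derive t 1 q ('D_w ('D_v f) (t *: w + (s *: v + x))).
  by move=> tI; apply: is_derive_line; exact: fvw.
have [||t tI] := @MVT_segment R q
   (fun t => 'D_w ('D_v f) (t *: w + (s *: v + x))) 0 h (ltW h0).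
- by move=> t; rewrite in_itv /= => /andP[t0 th]; apply: qd; rewrite !ltW.
- apply: derivable_within_continuous => t; rewrite in_itv /= => tI.
  by have [] := qd t tI.
rewrite subr0 {1 2}/q !scale0r !add0r => qE.
exists s, t; split => //.
by rewrite (addrCA (s *: v)) qE.
Qed.

Lemma mixed_derivative_comm f (U : set V) x v w : open U -> U x ->
  (forall u, U u -> [/\ derivable f u v, derivable f u w,
     derivable ('D_v f) u w & derivable ('D_w f) u v]) ->
  {for x, continuous ('D_w ('D_v f))} -> {for x, continuous ('D_v ('D_w f))} ->
  'D_w ('D_v f) x = 'D_v ('D_w f) x.
Proof.
move=> oU Ux fU cwv cvw.
apply/eqP; rewrite -subr_eq0 -normr_le0; apply/ler_addgt0Pr => e e0.
rewrite add0r.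
have e2 : 0 < e / 2 by rewrite divr_gt0.
have near_UFG (F G : V -> R) : {for x, continuous F} -> {for x, continuous G} ->
    \forall y \near x, [/\ U y, `|F x - F y| < e / 2 & `|G x - G y| < e / 2].
  move=> /cvgrPdist_lt/(_ _ e2) c1 /cvgrPdist_lt/(_ _ e2) c2.
  have c0 : nbhs x U by exact: open_nbhs_nbhs.
  by apply: filterS (filterI c0 (filterI c1 c2)) => y [? []].
have := near_UFG _ _ cwv cvw.
move=> /nbhs_ballP[d /= d0 dP].
pose M := `|v| + `|w| + 1.
have M0 : 0 < M by rewrite /M; have := normr_ge0 v; have := normr_ge0 w; lra.
pose h := d / (2 * M).
have h0 : 0 < h by rewrite divr_gt0// mulr_gt0.
have near_x s t : 0 <= s <= h -> 0 <= t <= h -> ball x d (t *: w + (s *: v + x)).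
  move=> /andP[s0 sh] /andP[t0 th].
  rewrite -ball_normE /= addrA addrC opprD addNKr normrN.
  apply: (le_lt_trans (ler_normD _ _)); rewrite !normrZ !ger0_norm//.
  apply: (@le_lt_trans _ _ (h * `|w| + h * `|v|)).
    by apply: lerD; apply: ler_wpM2r.
  rewrite -mulrDr.
  apply: (@lt_trans _ _ (h * M)); first by rewrite ltr_pM2l// /M; lra.
  have -> : h * M = d / 2 by rewrite /h; field; rewrite gt_eqF.
  lra.
have near_x' s t : 0 <= s <= h -> 0 <= t <= h -> ball x d (s *: v + (t *: w + x)).
  by move=> sI tI; rewrite addrCA; exact: near_x.
have [s [t [sI tI E1]]] : exists s t, [/\ 0 <= s <= h, 0 <= t <= h &
    f (h *: v + (h *: w + x)) - f (h *: v + x) - (f (h *: w + x) - f x) =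
    'D_w ('D_v f) (t *: w + (s *: v + x)) * h * h].
  apply: (second_difference h0) => s t sI tI.
    by have [/fU[fv _ _ _] _ _] := dP _ (near_x' _ _ sI tI); exact: fv.
  by have [/fU[_ _ fvw _] _ _] := dP _ (near_x _ _ sI tI); exact: fvw.
have [t' [s' [t'I s'I E2]]] : exists s t, [/\ 0 <= s <= h, 0 <= t <= h &
    f (h *: w + (h *: v + x)) - f (h *: w + x) - (f (h *: v + x) - f x) =
    'D_v ('D_w f) (t *: v + (s *: w + x)) * h * h].
  apply: (second_difference h0) => t' s' tI' sI'.
    by have [/fU[_ fw _ _] _ _] := dP _ (near_x _ _ sI' tI'); exact: fw.
  by have [/fU[_ _ _ fwv] _ _] := dP _ (near_x' _ _ sI' tI'); exact: fwv.
have E : 'D_w ('D_v f) (t *: w + (s *: v + x)) =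
         'D_v ('D_w f) (s' *: v + (t' *: w + x)).
  apply: (mulIf (lt0r_neq0 h0)); apply: (mulIf (lt0r_neq0 h0)).
  apply: (etrans (esym E1)); apply: (etrans _ E2).
  rewrite (addrCA (h *: v)).
  by move: (f _) (f _) (f _) (f x) => p q r z; ring.
have [_ d1 _] := dP _ (near_x _ _ sI tI).
have [_ _ d2] := dP _ (near_x' _ _ s'I t'I).
rewrite -(subrKA ('D_w ('D_v f) (t *: w + (s *: v + x)))) (splitr e).
apply: (le_trans (ler_normD _ _)); apply: lerD; first exact: (ltW d1).
rewrite E distrC; exact: (ltW d2).
Qed.

End mixed_derivatives.

Section poincare.
Context {R : realType}.
Local Notation leb := (@lebesgue_measure R).

Lemma continuous_sqr (T : topologicalType) (f : T -> R) (x : T) :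
  {for x, continuous f} -> {for x, continuous (fun t => f t ^+ 2)}.
Proof. by move=> fx; exact: (cvgM fx fx). Qed.

Lemma integral_sqr_itv_support (g : R -> R) (a b : R) : b <= a ->
  (forall t, b <= `|t| -> g t = 0) ->
  (\int[leb]_(t in `[(- a)%R, a]) (g t ^+ 2)%:E =
   \int[leb]_(t in `[(- b)%R, b]) (g t ^+ 2)%:E)%E.
Proof.
move=> ba g0; rewrite [LHS]integral_mkcond [RHS]integral_mkcond.
congr (integral _ _); apply/funext => t; rewrite !patchE.
case: ifPn => [_|/negP ta]; case: ifPn => [tb|/negP tb] //.
  rewrite g0 ?expr0n//; rewrite leNgt; apply/negP => tb'; apply: tb.
  by rewrite inE /= in_itv /= -ler_norml ltW.
exfalso; apply: ta; move: tb; rewrite !inE /= !in_itv /= -!ler_norml.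
by move/le_trans; apply.
Qed.

(* With [k = pi / (2 a)], the function [cos (k t)] is the ground state on
   [(-a, a)]: [g'^2 - k^2 g^2 + (k tan (k t) g^2)' = (g' + k tan (k t) g)^2]. *)
Lemma poincare_itv (g : R -> R) (a b : R) : 0 < b -> b < a ->
  (forall t, derivable g t 1) -> continuous ('D_1 g) ->
  (forall t, b <= `|t| -> g t = 0) ->
  (((pi / (2 * a)) ^+ 2)%:E * \int[leb]_(t in `[(- a)%R, a]) (g t ^+ 2)%:E <=
   \int[leb]_(t in `[(- a)%R, a]) ('D_1 g t ^+ 2)%:E)%E.
Proof.
move=> b0 ba gd cg g0.
have a0 : 0 < a by exact: lt_trans ba.
set k := pi / (2 * a).
have k0 : 0 < k by rewrite divr_gt0 ?pi_gt0// mulr_gt0.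
have gc : continuous g.
  by move=> t; apply/differentiable_continuous/derivable1_diffP/gd.
have cosk t : `|t| <= b -> 0 < cos (k * t).
  move=> tb; apply: cos_gt0_pihalf.
  rewrite -ltr_norml normrM (gtr0_norm k0).
  apply: (@le_lt_trans _ _ (k * b)); first by rewrite ler_pM2l.
  apply: (@lt_le_trans _ _ (k * a)); first by rewrite ltr_pM2l.
  by rewrite le_eqVlt; apply/orP; left; apply/eqP; rewrite /k; field; rewrite gt_eqF.
rewrite (integral_sqr_itv_support (ltW ba))//.
apply: (@le_trans _ _ (\int[leb]_(t in `[(- b)%R, b]) ('D_1 g t ^+ 2)%:E)%E); last first.
  apply: ge0_subset_integral => //=.
  - apply/measurable_EFinP/measurable_funX; apply: measurable_funS measurableT _ _ => //.
    exact: continuous_measurable_fun.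
  - by move=> t _; rewrite lee_fin sqr_ge0.
  - by apply: subset_itv; rewrite bnd_simp ?lerN2 ltW.
pose h t := k ^+ 2 * (cos (k * t)) ^- 2 * g t ^+ 2 +
  2 * (k * tan (k * t)) * (g t * 'D_1 g t).
pose F t := k * tan (k * t) * g t ^+ 2.
have dkt (t : R) : is_derive t (1 : R) (fun t : R => k * t) k.
  have -> : (fun t : R => k * t) = k \*: id by apply/funext.
  by apply: is_derive_eq; rewrite [LHS]mulr1.
have dtan (t : R) : `|t| <= b ->
    is_derive t (1 : R) (tan \o (fun t : R => k * t)) ((cos (k * t)) ^- 2 * k).
  move=> tb; apply: is_derive1_comp; apply: is_derive_tan.
  by rewrite gt_eqF// cosk.
have Fd (t : R) : `|t| <= b -> is_derive t (1 : R) F (h t).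
  move=> tb; have dT := dtan t tb.
  have dg : is_derive t (1 : R) g ('D_1 g t) by apply: DeriveDef.
  have -> : F = (k *: (tan \o (fun t : R => k * t))) * (g ^+ 2).
    by apply/funext => s; rewrite /F [in RHS]fctE /= !fctE.
  apply: is_derive_eq.
  rewrite /h !fctE /=.
  rewrite -[LHS]/(k * tan (k * t) * (2 * g t ^+ 1 * 'D_1 g t) +
    g t ^+ 2 * (k * (cos (k * t) ^- 2 * k))) expr1; ring.
have Jc : {within `[- b, b], continuous F}.
  apply: derivable_within_continuous => t; rewrite in_itv /= -ler_norml => tb.
  by have [] := Fd t tb.
have hc (t : R) : `|t| <= b -> {for t, continuous h}.
  move=> tb.
  have cn0 : cos (k * t) != 0 by rewrite gt_eqF// cosk.
  have ck : {for t, continuous (fun t => k * t)} by apply: cvgM; [exact: cvg_cst|exact: cvg_id].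
  apply: cvgD; last first.
    apply: cvgM; last by apply: cvgM; [exact: gc|exact: cg].
    apply: cvgM; first exact: cvg_cst.
    apply: cvgM; first exact: cvg_cst.
    by apply: (@continuous_comp _ _ _ (fun t : R => k * t) tan); [exact: ck|exact: continuous_tan].
  apply: cvgM; last by apply: continuous_sqr; exact: gc.
  apply: cvgM; first exact: cvg_cst.
  apply: cvgV; first by rewrite expf_neq0.
  apply: continuous_sqr.
  by apply: (@continuous_comp _ _ _ (fun t : R => k * t) cos); [exact: ck|exact: continuous_cos].
have hwc : {within `[- b, b], continuous h}.
  apply/subspace_continuousP => t /=; rewrite in_itv /= -ler_norml => tb.
  by apply: cvg_within_filter; exact: hc.
have inth : (\int[leb]_(t in `[(- b)%R, b]) (h t)%:E = 0)%E.
  have bb : - b < b by rewrite gtrN.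
  have dF : derivable_oo_LRcontinuous F (- b) b.
    have Fc t : `|t| <= b -> {for t, continuous F}.
      by case/Fd => Fdt _; apply/differentiable_continuous/derivable1_diffP.
    split.
    - move=> t; rewrite in_itv /= => /andP[tb1 tb2].
      by have [] := Fd t _; rewrite // ler_norml !ltW.
    - by apply: cvg_at_right_filter; apply: Fc; rewrite normrN ger0_norm// ltW.
    - by apply: cvg_at_left_filter; apply: Fc; rewrite ger0_norm// ltW.
  have F'h : {in `]- b, b[, derive1 F =1 h}.
    move=> t; rewrite in_itv /= => /andP[tb1 tb2].
    have tb : `|t| <= b by rewrite ler_norml !ltW.
    by have [_] := Fd t tb; rewrite derive1E.
  rewrite (continuous_FTC2 bb hwc dF F'h).
  have gb : g b = 0 by rewrite g0// ger0_norm// ltW.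
  have gNb : g (- b) = 0 by rewrite g0// normrN ger0_norm// ltW.
  by rewrite /F gb gNb expr0n /= !mulr0 subee.
have cJ : compact `[- b, b] by exact: segment_compact.
have intc (u : R -> R) : {within `[- b, b], continuous u} ->
    leb.-integrable `[- b, b] (EFin \o u).
  by move=> uc; exact: continuous_compact_integrable.
have ig' : leb.-integrable `[- b, b] (fun t => ('D_1 g t ^+ 2)%:E).
  apply: (intc (fun t => 'D_1 g t ^+ 2)); apply: continuous_subspaceT => t.
  exact: (continuous_sqr (cg t)).
have ig : leb.-integrable `[- b, b] (fun t => (g t ^+ 2)%:E).
  apply: (intc (fun t => g t ^+ 2)); apply: continuous_subspaceT => t.
  exact: (continuous_sqr (gc t)).
have ih : leb.-integrable `[- b, b] (fun t => (h t)%:E) by exact: intc.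
rewrite -integralZl// -[leRHS]adde0 -inth -integralD//.
apply: le_integral => //.
- exact: integrableZl.
- exact: integrableD.
move=> t; rewrite inE /= in_itv /= -ler_norml => tb.
rewrite lee_fin /h -subr_ge0.
have cn0 : cos (k * t) != 0 by rewrite gt_eqF// cosk.
have c2 : (cos (k * t)) ^- 2 = 1 + tan (k * t) ^+ 2.
  have c20 : cos (k * t) ^+ 2 != 0 by rewrite expf_neq0.
  by rewrite /tan expr_div_n -[X in X + _](divff c20) -mulrDl cos2Dsin2 div1r.
rewrite c2.
have -> : 'D_1 g t ^+ 2 + (k ^+ 2 * (1 + tan (k * t) ^+ 2) * g t ^+ 2 +
    2 * (k * tan (k * t)) * (g t * 'D_1 g t)) - k ^+ 2 * g t ^+ 2 =
  ('D_1 g t + k * tan (k * t) * g t) ^+ 2 by ring.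
exact: sqr_ge0.
Qed.
End poincare.

(** * Measure theory *)

Section open_measurable3.
Context {R : realType}.
Local Notation R3 := (measurableTypeR R * measurableTypeR R * measurableTypeR R)%type.

Let box (c : (rat * rat) * (rat * rat) * (rat * rat)) : set (R * R * R) :=
  (`]ratr c.1.1.1, ratr c.1.1.2[ `*` `]ratr c.1.2.1, ratr c.1.2.2[)
  `*` `]ratr c.2.1, ratr c.2.2[.

Let rational_itv_ball (x e : R) : 0 < e ->
  exists l r : rat, `]ratr l, ratr r[%classic x /\ `]ratr l, ratr r[ `<=` ball x e.
Proof.
move=> e0.
have /rat_in_itvoo[l] : x - e < x by rewrite gtrBl.
have /rat_in_itvoo[r] : x < x + e by rewrite ltrDl.
rewrite !in_itv /= => /andP[xr re] /andP[le lx].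
exists l, r; split; first by rewrite /= in_itv /= lx xr.
move=> y /=; rewrite in_itv /= => /andP[ly yr].
rewrite -ball_normE /= ltr_distlC; apply/andP; split.
  exact: lt_trans ly.
exact: lt_trans yr re.
Qed.

Lemma open_measurable3 (O : set (R * R * R)) : open O -> measurable (O : set R3).
Proof.
move=> oO.
have -> : O = \bigcup_(c in [set c | box c `<=` O]) box c.
  apply/seteqP; split => [[[x y] z] Oq|q [c /= cO /cO//]].
  have : nbhs (x, y, z) O by exact: open_nbhs_nbhs.
  move=> /nbhs_ballP[e /= e0 eO].
  have [l1 [r1 [x1 s1]]] := rational_itv_ball x e0.
  have [l2 [r2 [x2 s2]]] := rational_itv_ball y e0.
  have [l3 [r3 [x3 s3]]] := rational_itv_ball z e0.
  exists (((l1, r1), (l2, r2)), (l3, r3)) => //=.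
  by move=> [[x' y'] z'] [[/s1 ? /s2 ?] /s3 ?]; apply: eO.
rewrite bigcup_mkcond.
have -> : \bigcup_c (if c \in [set c | box c `<=` O] then box c else set0) =
   \bigcup_n (if unpickle n is Some c then
     (if c \in [set c | box c `<=` O] then box c else set0) else set0).
  apply/seteqP; split => [q [c _ qc]|q [n _]].
    by exists (pickle c); [exact: I|rewrite pickleK; exact: qc].
  by case: (unpickle n) => // c qc; exists c.
apply: (@bigcupT_measurable _ R3) => n; case: unpickle => [c|]; last exact: measurable0.
case: ifPn => _; last exact: measurable0.
by apply: measurableX; [apply: measurableX|]; exact: measurable_itv.
Qed.

Lemma continuous_on_open_measurable3 (O : set (R * R * R)) (f : R3 -> R) :
  open O -> (forall q, O q -> {for q, continuous (f : R * R * R -> R)}) ->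
  measurable_fun O f.
Proof.
move=> oO fc; apply: (measurability _ (RGenOpens.measurableE R)).
move=> _ [_ [a [b ->] <-]]; apply: open_measurable3.
rewrite openE => q [Oq fq].
apply: filterI; first exact: open_nbhs_nbhs.
by apply: (fc _ Oq); apply: open_nbhs_nbhs; split => //; exact: interval_open.
Qed.

End open_measurable3.

Lemma continuous_on_open_measurable_g_sigma (R : realType)
    (O : set (R * R * R))
    (f : measurableTypeR R * measurableTypeR R * measurableTypeR R ->
         g_sigma_algebraType (@open ('rV[R]_3 * R)%type)) :
  open O -> (forall q, O q -> {for q, continuous (f : R * R * R -> 'rV[R]_3 * R)}) ->
  measurable_fun O f.
Proof.
move=> oO fc; apply: (@measurability _ _ _ (g_sigma_algebraType (@open ('rV[R]_3 * R)%type)) _ _ (@open ('rV[R]_3 * R)%type)) => // _ [B oB <-].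
apply: open_measurable3.
rewrite openE => q [Oq fq].
apply: filterI; first exact: open_nbhs_nbhs.
by apply: (fc _ Oq); apply: open_nbhs_nbhs; split.
Qed.

Section integral_image_density.
Local Open Scope ereal_scope.
Context d1 d2 (X : measurableType d1) (Y : measurableType d2) (R : realType).
Variables (m : {measure set X -> \bar R}) (mu : {measure set Y -> \bar R}).
Variables (psi : X -> Y) (D : set X) (A : set Y) (w : X -> R).
Hypotheses (mD : measurable D) (mA : measurable A).
Hypotheses (psiDA : forall x, D x -> A (psi x)) (mpsi : measurable_fun D psi).
Hypotheses (mw : measurable_fun D w) (w0 : forall x, D x -> (0 <= w x)%R).
Hypothesis muE : forall E, measurable E -> E `<=` A ->
  mu E = \int[m]_(x in D `&` psi @^-1` E) (w x)%:E.

Import HBNNSimple.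

Let integral_image_density_nnsfun (f : {nnsfun Y >-> R}) :
  \int[mu]_(y in A) (f y)%:E = \int[m]_(x in D) ((f (psi x))%:E * (w x)%:E).
Proof.
have mfk k : measurable (D `&` psi @^-1` (f @^-1` [set k])) by exact: mpsi.
have mIk k : measurable_fun D (fun x => (\1_(f @^-1` [set k]) (psi x) : R)).
  apply: (measurable_comp (F := setT)) => //.
transitivity (\sum_(k \in range f) k%:E * mu (A `&` f @^-1` [set k])).
  under eq_integral do rewrite fimfunE -fsumEFin//.
  rewrite ge0_integral_fsum//; last 2 first.
  - by move=> y; exact/measurable_EFinP/measurable_funM.
  - by move=> y x _; rewrite nnfun_muleindic_ge0.
  apply: eq_fsbigr => r _; rewrite integralZl_indic_nnsfun// integral_indic//=.
  by rewrite setIC.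
transitivity (\int[m]_(x in D) \sum_(k \in range f)
    ((k * \1_(f @^-1` [set k]) (psi x))%:E * (w x)%:E)); last first.
  apply: eq_integral => x; rewrite inE => Dx.
  rewrite -ge0_mule_fsuml; first by rewrite fsumEFin// -fimfunE.
  by move=> k; rewrite nnfun_muleindic_ge0.
rewrite ge0_integral_fsum//; last 2 first.
- move=> k; apply: emeasurable_funM; last exact/measurable_EFinP.
  by apply/measurable_EFinP; apply: measurable_funM.
- by move=> k x Dx; rewrite mule_ge0 ?nnfun_muleindic_ge0// lee_fin w0.
apply: eq_fsbigr => k; rewrite inE => -[y _ <-].
under [RHS]eq_integral do rewrite EFinM -muleA.
rewrite ge0_integralZl_EFin//; last 2 first.
- by move=> x Dx; rewrite -EFinM lee_fin mulr_ge0// w0.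
- by apply/measurable_EFinP; apply: measurable_funM.
congr (_ * _); rewrite muE; [|exact: measurableI|exact: subIsetl].
have -> : D `&` psi @^-1` (A `&` f @^-1` [set f y]) =
    D `&` psi @^-1` (f @^-1` [set f y]).
  by apply/seteqP; split => [x [Dx [_ ?]]|x [Dx ?]]; split => //; split => //; exact: psiDA.
rewrite integral_mkcondr; apply: eq_integral => x; rewrite inE => Dx.
rewrite patchE indicE; case: ifPn => xk.
  by rewrite mem_set ?mul1e//; move: xk; rewrite inE.
by rewrite memNset ?mul0e// => xk'; move: xk; rewrite notin_setE; exact.
Qed.

Lemma ge0_integral_image_density (f : Y -> \bar R) : measurable_fun A f ->
  (forall y, A y -> 0 <= f y) ->
  \int[mu]_(y in A) f y = \int[m]_(x in D) (f (psi x) * (w x)%:E).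
Proof.
move=> mf f0; pose f_ := nnsfun_approx mA mf.
have cf : \int[mu]_(y in A) (f_ n y)%:E @[n --> \oo] --> \int[mu]_(y in A) f y.
  rewrite (_ : \int[mu]_(y in A) f y =
      \int[mu]_(y in A) limn (fun n => (f_ n y)%:E)); last first.
    apply: eq_integral => y; rewrite inE => Ay; apply/esym/cvg_lim => //.
    exact: cvg_nnsfun_approx.
  apply: cvg_monotone_convergence => //.
  - by move=> n; exact/measurable_EFinP/measurable_funTS.
  - by move=> n y _; rewrite lee_fin.
  - by move=> y _ p q pq; rewrite lee_fin; exact/lefP/nd_nnsfun_approx.
have mfpsi n : measurable_fun D (fun x => f_ n (psi x)).
  by apply: (measurable_comp (F := setT)).
have cw : \int[m]_(x in D) ((f_ n (psi x))%:E * (w x)%:E) @[n --> \oo] -->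
    \int[m]_(x in D) (f (psi x) * (w x)%:E).
  rewrite (_ : \int[m]_(x in D) (f (psi x) * (w x)%:E) =
      \int[m]_(x in D) limn (fun n => (f_ n (psi x))%:E * (w x)%:E)); last first.
    apply: eq_integral => x; rewrite inE => Dx; apply/esym/cvg_lim => //.
    apply: cvgeZr => //.
    by apply: cvg_nnsfun_approx => //; exact: psiDA.
  apply: cvg_monotone_convergence => //.
  - by move=> n; apply: emeasurable_funM; exact/measurable_EFinP.
  - by move=> n x Dx; rewrite mule_ge0// lee_fin// w0.
  - move=> x Dx p q pq; apply: lee_wpmul2r; first by rewrite lee_fin w0.
    by rewrite lee_fin; exact/lefP/nd_nnsfun_approx.
move: cf; rewrite (_ : (fun n => \int[mu]_(y in A) (f_ n y)%:E) =
  (fun n => \int[m]_(x in D) ((f_ n (psi x))%:E * (w x)%:E))); last first.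
  by apply/funext => n; exact: integral_image_density_nnsfun.
by move=> cf; exact: cvg_unique cf cw.
Qed.

End integral_image_density.

Section lebesgue_measure_boxes.
Context {R : realType}.
Local Notation leb := (@lebesgue_measure R).
Local Notation R1 := (measurableTypeR R).

Lemma lebesgue_measure_cc (x y : R) : x <= y -> leb `[x, y]%classic = (y - x)%:E.
Proof.
move=> xy; rewrite [LHS](lebesgue_measure_itv `[x, y]) /= lte_fin.
by case: ltP => // yx; rewrite (le_anti (introT andP (conj xy yx))) subrr.
Qed.

Lemma lebesgue_measure_box (A B C : set R1) :
  measurable A -> measurable B -> measurable C ->
  ((leb \x leb) \x leb)%E ((A `*` B) `*` C) = (leb A * leb B * leb C)%E.
Proof.
move=> mA mB mC.
transitivity ((leb \x leb)%E (A `*` B) * leb C)%E.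
  by rewrite product_measure1E//; exact: measurableX.
by congr (_ * _)%E; rewrite product_measure1E.
Qed.

Lemma lebesgue_measure2_sigma_finite : sigma_finite setT (leb \x leb)%E.
Proof.
pose I (n : nat) : set R1 := `[- n%:R, n%:R]%classic.
exists (fun n => I n `*` I n).
  apply/seteqP; split => // -[x y] _.
  exists (Num.truncn `|x| + Num.truncn `|y|).+1 => //.
  have xn := truncnS_gt `|x|; have yn := truncnS_gt `|y|.
  split; rewrite /I /= in_itv /= -ler_norml.
    by rewrite (le_trans (ltW xn))// ler_nat ltnS leq_addr.
  by rewrite (le_trans (ltW yn))// ler_nat ltnS leq_addl.
move=> n; have mI : measurable (I n) by exact: measurable_itv.
split; first exact: measurableX.
have -> : (leb \x leb)%E (I n `*` I n) = (leb (I n) * leb (I n))%E.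
  by rewrite product_measure1E.
have -> : leb (I n) = (n%:R - - n%:R)%:E.
  have nn : - n%:R <= n%:R :> R by rewrite (@le_trans _ _ 0) ?oppr_le0.
  exact: lebesgue_measure_cc nn.
by rewrite -EFinM ltry.
Qed.

(* An alias, as no sigma-finite structure is inferred for [leb \x leb] itself. *)
Definition lebesgue_measure2 : set (R1 * R1)%type -> \bar R := (leb \x leb)%E.

HB.instance Definition _ := Measure.on lebesgue_measure2.

HB.instance Definition _ := Measure_isSigmaFinite.Build _ _ _
  lebesgue_measure2 lebesgue_measure2_sigma_finite.

End lebesgue_measure_boxes.

Lemma ge0_le_integral_setX d1 d2 (T1 : measurableType d1) (T2 : measurableType d2)
    (R : realType) (m1 : {sigma_finite_measure set T1 -> \bar R})
    (m2 : {sigma_finite_measure set T2 -> \bar R})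
    (E : set T1) (I : set T2) (F G : T1 * T2 -> \bar R) :
  measurable E -> measurable I ->
  measurable_fun (E `*` I) F -> measurable_fun (E `*` I) G ->
  (forall q, (E `*` I) q -> (0 <= F q)%E) -> (forall q, (E `*` I) q -> (0 <= G q)%E) ->
  (forall x, E x -> \int[m2]_(y in I) F (x, y) <= \int[m2]_(y in I) G (x, y))%E ->
  (\int[m1 \x m2]_(q in E `*` I) F q <= \int[m1 \x m2]_(q in E `*` I) G q)%E.
Proof.
move=> mE mI mF mG F0 G0 FG.
have mEI : measurable (E `*` I) by exact: measurableX.
rewrite integral_mkcond [leRHS]integral_mkcond.
have mrF : measurable_fun setT (F \_ (E `*` I)) by apply/(measurable_restrictT _ mEI).
have mrG : measurable_fun setT (G \_ (E `*` I)) by apply/(measurable_restrictT _ mEI).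
have rF0 q : (0 <= (F \_ (E `*` I)) q)%E by apply: erestrict_ge0.
have rG0 q : (0 <= (G \_ (E `*` I)) q)%E by apply: erestrict_ge0.
rewrite (fubini_tonelli1 _ mrF)// (fubini_tonelli1 _ mrG)//.
apply: ge0_le_integral => //.
- by move=> x _; apply: integral_ge0.
- exact: measurable_fun_fubini_tonelli_F.
- exact: measurable_fun_fubini_tonelli_F.
have secE (H : T1 * T2 -> \bar R) x : fubini_F m2 (H \_ (E `*` I)) x =
    if x \in E then (\int[m2]_(y in I) H (x, y))%E else 0%E.
  rewrite /fubini_F; case: ifPn => xE.
    rewrite [RHS]integral_mkcond; apply: eq_integral => y _.
    by rewrite !patchE in_setX xE.
  by apply: integral0_eq => y _; rewrite patchE in_setX (negbTE xE).
move=> x _; rewrite !secE; case: ifPn => // xE.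
by apply: FG; rewrite inE in xE.
Qed.

Lemma weighted_poincare_itv (R : realType) (g : R -> R) (w : R -> R)
    (a b w0 c1 c2 : R) : 0 < b -> b < a ->
  (forall t, derivable g t 1) -> continuous ('D_1 g) ->
  (forall t, b <= `|t| -> g t = 0) ->
  0 <= w0 -> 0 <= c1 -> 0 <= c2 ->
  measurable_fun `[- a, a] w ->
  (forall t, `|t| <= a -> c1 * w0 <= w t <= c2 * w0) ->
  (\int[@lebesgue_measure R]_(t in `[(- a)%R, a])
      ((c1 * (pi / (2 * a)) ^+ 2)%:E * ((g t ^+ 2)%:E * (w t)%:E)) <=
   \int[@lebesgue_measure R]_(t in `[(- a)%R, a])
      (c2%:E * (('D_1 g t ^+ 2)%:E * (w t)%:E)))%E.
Proof.
move=> b0 ba gd cg g0 w00 c10 c20 mw wb.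
have mI : measurable (`[- a, a]%classic : set (measurableTypeR R)).
  exact: measurable_itv.
have tI (t : R) : `[- a, a]%classic t -> `|t| <= a.
  by rewrite /= in_itv /= -ler_norml.
have wpos t : `[- a, a]%classic t -> 0 <= w t.
  move=> /tI/wb/andP[+ _]; apply: le_trans; exact: mulr_ge0.
have gc : continuous g.
  by move=> t; apply/differentiable_continuous/derivable1_diffP/gd.
have mg2 : measurable_fun `[- a, a] (fun t => g t ^+ 2).
  by apply: measurable_funX; apply: measurable_funTS; exact: continuous_measurable_fun.
have mg'2 : measurable_fun `[- a, a] (fun t => 'D_1 g t ^+ 2).
  by apply: measurable_funX; apply: measurable_funTS; exact: continuous_measurable_fun.
set k2 := (pi / (2 * a)) ^+ 2.
have k20 : 0 <= k2 by exact: sqr_ge0.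
apply: (@le_trans _ _ (\int[@lebesgue_measure R]_(t in `[(- a)%R, a])
   ((c1 * c2 * w0 * k2)%:E * (g t ^+ 2)%:E))%E).
  apply: ge0_le_integral => //.
  - move=> t It; rewrite -!EFinM lee_fin; apply: mulr_ge0; first exact: mulr_ge0.
    by apply: mulr_ge0; [exact: sqr_ge0|exact: wpos].
  - by apply/measurable_EFinP; apply: measurable_funM => //; apply: measurable_funM.
  - by apply/measurable_EFinP; apply: measurable_funM.
  move=> t It; rewrite -!EFinM lee_fin.
  have -> : c1 * c2 * w0 * k2 * g t ^+ 2 = c1 * k2 * (g t ^+ 2 * (c2 * w0)) by ring.
  apply: ler_wpM2l; first exact: mulr_ge0.
  apply: ler_wpM2l; first exact: sqr_ge0.
  by have /andP[] := wb _ (tI _ It).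
apply: (@le_trans _ _ (\int[@lebesgue_measure R]_(t in `[(- a)%R, a])
   ((c1 * c2 * w0)%:E * ('D_1 g t ^+ 2)%:E))%E); last first.
  apply: ge0_le_integral => //.
  - move=> t It; rewrite -!EFinM lee_fin; apply: mulr_ge0; last exact: sqr_ge0.
    by rewrite !mulr_ge0.
  - by apply/measurable_EFinP; apply: measurable_funM.
  - by apply/measurable_EFinP; apply: measurable_funM => //; apply: measurable_funM.
  move=> t It; rewrite -!EFinM lee_fin.
  have -> : c1 * c2 * w0 * 'D_1 g t ^+ 2 = c2 * ('D_1 g t ^+ 2 * (c1 * w0)) by ring.
  apply: ler_wpM2l => //.
  apply: ler_wpM2l; first exact: sqr_ge0.
  by have /andP[] := wb _ (tI _ It).
have c0 : 0 <= c1 * c2 * w0 by rewrite !mulr_ge0.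
have scaleE (c : R) (h : R -> R) : 0 <= c -> measurable_fun `[- a, a] h ->
    (forall t, 0 <= h t) ->
    (\int[@lebesgue_measure R]_(t in `[(- a)%R, a]) (c%:E * (h t)%:E) =
     c%:E * \int[@lebesgue_measure R]_(t in `[(- a)%R, a]) (h t)%:E)%E.
  move=> ? mh h0; rewrite ge0_integralZl_EFin//.
    by move=> t _; rewrite lee_fin.
  exact/measurable_EFinP.
rewrite [leRHS](scaleE _ _ c0 mg'2); last by move=> t; exact: sqr_ge0.
rewrite [leLHS](scaleE _ _ _ mg2); [|exact: mulr_ge0|by move=> t; exact: sqr_ge0].
rewrite EFinM -muleA; apply: lee_wpmul2l; first by rewrite lee_fin.
exact: (poincare_itv b0 ba gd cg g0).
Qed.

(** * Geometry of a chart *)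

Lemma prod_fst_cvg (T1 T2 : topologicalType) (y : T1 * T2) : z.1 @[z --> y] --> y.1.
Proof. by case: y => ? ?; exact: cvg_fst. Qed.

Lemma prod_snd_cvg (T1 T2 : topologicalType) (y : T1 * T2) : z.2 @[z --> y] --> y.2.
Proof. by case: y => ? ?; exact: cvg_snd. Qed.

Section matrix_continuity.
Context {R : realType} {T : topologicalType}.

Lemma continuous_det n (F : T -> 'M[R]_n) (x : T) :
  (forall i j, {for x, continuous (fun y => F y i j)}) ->
  {for x, continuous (fun y => \det (F y))}.
Proof.
move=> Fc; rewrite /determinant.
apply: cvg_big => [|s _]; first exact: add_continuous.
apply: cvgM; first exact: cvg_cst.
apply: cvg_big => [|i _]; first exact: mul_continuous.
exact: Fc.
Qed.

End matrix_continuity.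

Section smooth_coordinates.
Context {R : realType} {V : normedModType R}.
Implicit Types (F G : V -> 'rV[R]_3) (A : set V).

Lemma smooth_on_continuous (W : normedModType R) A (F : V -> W) x :
  smooth_on A F -> A x -> {for x, continuous F}.
Proof. by move=> sF Ax; have [] := sF [::] x Ax. Qed.

Lemma smooth_on_derivable (W : normedModType R) A (F : V -> W) x v :
  smooth_on A F -> A x -> derivable F x v.
Proof. by move=> sF Ax; have [_] := sF [::] x Ax; exact. Qed.

Lemma smooth_on_derive (W : normedModType R) A (F : V -> W) v :
  smooth_on A F -> smooth_on A ('D_v F).
Proof.
move=> sF s x Ax; have := sF (rcons s v) x Ax.
by rewrite /iter_derive foldr_rcons.
Qed.

Lemma derivable_coord F x v (j : 'I_3) :
  derivable F x v -> derivable (fun y => F y 0 j) x v.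
Proof. by move=> /derivable_mxP; exact. Qed.

Lemma derive_coord F x v (j : 'I_3) :
  derivable F x v -> 'D_v (fun y => F y 0 j) x = ('D_v F x) 0 j.
Proof. by move=> Fv; rewrite (derive_mx Fv) mxE. Qed.

Lemma derive_dot F G x v : derivable F x v -> derivable G x v ->
  'D_v (fun y => dot (F y) (G y)) x = dot ('D_v F x) (G x) + dot (F x) ('D_v G x).
Proof.
move=> Fv Gv.
have FGv (j : 'I_3) :
    is_derive x v ((fun y => F y 0 j) * (fun y => G y 0 j))
      (F x 0 j *: ('D_v G x) 0 j + G x 0 j *: ('D_v F x) 0 j).
  have dF : is_derive x v (fun y => F y 0 j) (('D_v F x) 0 j).
    by apply: DeriveDef; [exact: derivable_coord|exact: derive_coord].
  have dG : is_derive x v (fun y => G y 0 j) (('D_v G x) 0 j).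
    by apply: DeriveDef; [exact: derivable_coord|exact: derive_coord].
  exact: is_deriveM.
have -> : (fun y => dot (F y) (G y)) =
    \sum_(j < 3) ((fun y => F y 0 j) * (fun y => G y 0 j)).
  by apply/funext => y; rewrite dotE fct_sumE; apply: eq_bigr.
rewrite derive_sum; last by move=> j; exact: (@ex_derive _ _ _ _ _ _ _ (FGv j)).
rewrite !dotE -big_split /=; apply: eq_bigr => j _.
rewrite (@derive_val _ _ _ _ _ _ _ (FGv j)) [LHS]addrC; congr (_ + _); exact: mulrC.
Qed.

Lemma derive_eq0_on_open (W : normedModType R) (A : set V) (h : V -> W) (c : W) x v :
  open A -> A x -> (forall y, A y -> h y = c) -> 'D_v h x = 0.
Proof.
move=> oA Ax hc; rewrite (@near_eq_derive _ _ _ h (cst c)) ?derive_cst//.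
by near=> y; apply: hc; near: y; exact: open_nbhs_nbhs.
Unshelve. all: by end_near. Qed.

End smooth_coordinates.

Lemma derive_affine (R : realType) (V : normedModType R) (p n : V) (t : R) :
  'D_1 (fun s : R => p + s *: n) t = n.
Proof.
apply: lim_near_cst => //; near=> h.
rewrite /= opprD addrACA subrr add0r -scalerBl addrK scalerA mulrA.
by rewrite mulVf ?mul1r ?scale1r//; near: h; exact: nbhs_dnbhs_neq.
Unshelve. all: by end_near. Qed.

Section layer_jacobian.
Context {R : realType}.
Variables (N : 'rV[R]_3 -> 'rV[R]_3) (phi : R * R -> 'rV[R]_3).
Variables (u : R * R) (t : R).
Hypothesis dphi : forall v, derivable phi u v.
Hypothesis dN : forall v, derivable (N \o phi) u v.

Lemma jac3_layer_coord : jac3 (layer_coord N phi) (u, t) =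
  col_mx (jac2 phi u + t *: jac2 (N \o phi) u) (N (phi u)) :> 'M[R]_(2 + 1, 3).
Proof.
apply/matrixP => i j; rewrite [LHS]mxE.
case: (@splitP 2 1 i) => k ik.
  have -> : i = lshift 1 k by apply/val_inj.
  rewrite col_mxEu !mxE.
  have -> : @basis3 R (lshift 1 k) = (basis2 k, 0).
    rewrite /basis3 /basis2 /=; congr (_, _).
    by rewrite (_ : ((k : nat) == 2) = false)//; apply/negbTE; rewrite neq_ltn ltn_ord.
  have Lw (h : R) : (fun y : R * R => (y, t)) (h *: basis2 k + u) =
      h *: (basis2 k, 0) + (fun y : R * R => (y, t)) u.
    by congr (_, _); rewrite /= scaler0 add0r.
  have <- := @derive_along R _ _ _ (layer_coord N phi) (fun y => (y, t)) u (basis2 k) (basis2 k, 0) Lw.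
  rewrite (_ : (layer_coord N phi \o (fun y => (y, t))) = phi + t *: (N \o phi))//.
  by rewrite deriveD ?deriveZ ?mxE//; exact: derivableZ.
have -> : i = rshift 2 k by apply/val_inj.
rewrite col_mxEd (ord1 k).
have -> : @basis3 R (rshift 2 0) = (0, 1) by rewrite /basis3.
have Lw (h : R) : (fun s : R => (u, s)) (h *: 1 + t) =
    h *: (0, 1) + (fun s : R => (u, s)) t.
  by congr (_, _); rewrite /= scaler0 add0r.
have <- := @derive_along R _ _ _ (layer_coord N phi) (fun s : R => (u, s)) t (1 : R) (0, 1) Lw.
by rewrite (derive_affine (phi u) (N (phi u)) t).
Qed.

End layer_jacobian.

Section chart_geometry.
Context {R : realType}.
Variables (S : set 'rV[R]_3) (N : 'rV[R]_3 -> 'rV[R]_3).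
Variables (U : set (R * R)) (phi : R * R -> 'rV[R]_3).
Hypotheses (chart : local_param S U phi) (normalN : unit_normal_field S N).

Let openU : open U. Proof. by case: chart. Qed.
Let smooth_phi : smooth_on U phi. Proof. by case: chart. Qed.
Let smooth_N : smooth_on U (N \o phi). Proof. by case: (normalN chart). Qed.

Let dotNN u : U u -> dot (N (phi u)) (N (phi u)) = 1.
Proof. by move=> Uu; have [_ /(_ u Uu)[/enorm_eq1]] := normalN chart. Qed.

Let dot_jac2 (F : R * R -> 'rV[R]_3) u (n : 'rV[R]_3) i :
  (jac2 F u *m n^T) i 0 = dot ('D_(basis2 i) F u) n.
Proof. by rewrite dotE mxE; apply: eq_bigr => j _; rewrite !mxE. Qed.

Let dot_tangent_normal u i : U u -> dot ('D_(basis2 i) phi u) (N (phi u)) = 0.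
Proof.
move=> Uu; have [_ /(_ u Uu)[_ /matrixP/(_ i 0)]] := normalN chart.
by rewrite dot_jac2 [RHS]mxE.
Qed.

Let dot_dN_normal u v : U u -> dot ('D_v (N \o phi) u) (N (phi u)) = 0.
Proof.
move=> Uu.
have dN := smooth_on_derivable (v := v) smooth_N Uu.
have /= := derive_dot dN dN.
rewrite (@derive_eq0_on_open _ _ _ U _ (1 : R) u v openU Uu) => [|y Uy]; last exact: dotNN.
by rewrite (dotC (N (phi u))) => /esym/eqP; rewrite -mulr2n mulrn_eq0 /= => /eqP.
Qed.

Let dot_dN_tangent u i j : U u ->
  dot ('D_(basis2 i) (N \o phi) u) ('D_(basis2 j) phi u) = - second_form N phi u i j.
Proof.
move=> Uu.
have dN := smooth_on_derivable (v := basis2 i) smooth_N Uu.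
have dphi := smooth_on_derivable (v := basis2 i) (smooth_on_derive (basis2 j) smooth_phi) Uu.
have := derive_dot dphi dN.
rewrite (@derive_eq0_on_open _ _ _ U _ (0 : R) u _ openU Uu) => [|y Uy]; last exact: dot_tangent_normal.
rewrite mxE => /esym/eqP; rewrite addrC addr_eq0 => /eqP <-.
exact: dotC.
Qed.

Lemma layer_density_pencil u t : U u ->
  \det (jac3 (layer_coord N phi) (u, t)) * \det (jac3 (layer_coord N phi) (u, 0)) =
  \det (first_form phi u - t *: second_form N phi u).
Proof.
move=> Uu.
have dphi v := smooth_on_derivable (v := v) smooth_phi Uu.
have dN v := smooth_on_derivable (v := v) smooth_N Uu.
rewrite !(jac3_layer_coord _ dphi dN) scale0r addr0 -[\det (col_mx (jac2 phi u) _)]det_tr.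
rewrite -det_mulmx tr_col_mx (@mul_col_row _ 2 1 3 2 1).
have perp : jac2 phi u *m (N (phi u))^T = 0.
  by apply/matrixP => i j; rewrite (ord1 j) dot_jac2 dot_tangent_normal// mxE.
have dNperp : jac2 (N \o phi) u *m (N (phi u))^T = 0.
  by apply/matrixP => i j; rewrite (ord1 j) dot_jac2 dot_dN_normal// mxE.
have Aperp : (jac2 phi u + t *: jac2 (N \o phi) u) *m (N (phi u))^T = 0.
  by rewrite mulmxDl -scalemxAl perp dNperp scaler0 addr0.
rewrite Aperp (@det_lblock _ 2 1).
have -> : N (phi u) *m (N (phi u))^T = 1%:M.
  by apply/matrixP => i j; rewrite !ord1 [RHS]mxE eqxx; exact: dotNN.
rewrite det1 mulr1 mulmxDl -/(first_form phi u) -scalemxAl; congr (\det (_ + _)).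
rewrite -scalerN; congr (_ *: _); apply/matrixP => i j.
rewrite [RHS]mxE -dot_dN_tangent// dotE mxE; apply: eq_bigr => k _.
by rewrite !mxE.
Qed.

Lemma second_form_sym u i j : U u -> second_form N phi u i j = second_form N phi u j i.
Proof.
move=> Uu; rewrite !mxE.
suff DD : 'D_(basis2 i) ('D_(basis2 j) phi) u = 'D_(basis2 j) ('D_(basis2 i) phi) u.
  by rewrite -[fun v => 'D_(basis2 j) phi v]/('D_(basis2 j) phi) DD.
have dd (v w : R * R) y : U y -> derivable ('D_v phi) y w.
  by move=> Uy; exact: smooth_on_derivable (smooth_on_derive v smooth_phi) Uy.
have d1 (v : R * R) y : U y -> derivable phi y v.
  by move=> Uy; exact: smooth_on_derivable smooth_phi Uy.
apply/rowP => k.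
have coordDD (v w : R * R) y : U y ->
    'D_w ('D_v (fun y => phi y 0 k)) y = ('D_w ('D_v phi) y) 0 k.
  move=> Uy; rewrite -derive_coord; last exact: dd.
  apply: near_eq_derive; near=> z; apply: derive_coord; apply: d1.
  by near: z; exact: open_nbhs_nbhs.
have coordD (v w : R * R) y : U y -> derivable ('D_v (fun y => phi y 0 k)) y w.
  move=> Uy; apply: (@near_eq_derivable _ _ _ (fun z => 'D_v phi z 0 k)).
    near=> z; apply/esym/derive_coord; apply: d1.
    by near: z; exact: open_nbhs_nbhs.
  exact/derivable_coord/dd.
have cDD (v w : R * R) : {for u, continuous ('D_w ('D_v (fun y => phi y 0 k)))}.
  have c0 : {for u, continuous (fun y => ('D_w ('D_v phi) y) 0 k)}.
    apply: (@continuous_comp _ _ _ ('D_w ('D_v phi)) (fun M : 'rV[R]_3 => M 0 k)).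
      exact: smooth_on_continuous (smooth_on_derive w (smooth_on_derive v smooth_phi)) Uu.
    exact: coord_continuous.
  have : 'D_w ('D_v (fun y => phi y 0 k)) y @[y --> u] --> ('D_w ('D_v phi) u) 0 k.
    apply: cvg_trans c0; apply: near_eq_cvg.
    have nU : nbhs u U by exact: open_nbhs_nbhs.
    by apply: filterS nU => z Uz; apply/esym; exact: (coordDD v w z Uz).
  by rewrite -(coordDD v w u Uu).
apply: (etrans (esym (coordDD (basis2 j) (basis2 i) u Uu))).
apply: (etrans _ (coordDD (basis2 i) (basis2 j) u Uu)).
apply: (mixed_derivative_comm openU Uu) => [y Uy| |].
- split.
  + exact: derivable_coord (d1 (basis2 j) y Uy).
  + exact: derivable_coord (d1 (basis2 i) y Uy).
  + exact: (coordD (basis2 j) (basis2 i) y Uy).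
  + exact: (coordD (basis2 i) (basis2 j) y Uy).
- exact: (cDD (basis2 j) (basis2 i)).
- exact: (cDD (basis2 i) (basis2 j)).
Unshelve. all: by end_near. Qed.

End chart_geometry.

Lemma det_mx2 (R : comNzRingType) (A : 'M[R]_2) :
  \det A = A 0 0 * A 1 1 - A 0 1 * A 1 0.
Proof.
rewrite (expand_det_row _ 0) !big_ord_recl big_ord0 addr0 /cofactor !det_mx11 !mxE /=.
rewrite expr0 expr1 mul1r mulN1r mulrN.
by congr (A _ _ * A _ _ - A _ _ * A _ _); apply/val_inj.
Qed.

Lemma mulmx2E (R : comNzRingType) (A B : 'M[R]_2) i j :
  (A *m B) i j = A i 0 * B 0 j + A i 1 * B 1 j.
Proof.
rewrite mxE !big_ord_recl big_ord0 addr0.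
by congr (_ + A _ _ * B _ _); apply/val_inj.
Qed.

Lemma entry_subZ (R : comNzRingType) m n (A B : 'M[R]_(m, n)) t i j :
  (A - t *: B) i j = A i j - t * B i j.
Proof. by rewrite !mxE. Qed.

Section layer_density.
Context {R : realType}.
Variables (S : set 'rV[R]_3) (N : 'rV[R]_3 -> 'rV[R]_3) (a : R).
Variables (U : set (R * R)) (phi : R * R -> 'rV[R]_3).
Hypotheses (chart : local_param S U phi) (normalN : unit_normal_field S N).
Hypotheses (a_gt0 : 0 < a) (embed : layer_embedding S N a).

Definition layer_density (q : R * R * R) : R := Num.sqrt (\det (layer_metric N phi q)).

Lemma layer_densityE q : layer_density q = `|\det (jac3 (layer_coord N phi) q)|.
Proof. by rewrite /layer_density /layer_metric det_mulmx det_tr -expr2 sqrtr_sqr. Qed.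

Lemma layer_jac_unit u t : U u -> `|t| <= a ->
  jac3 (layer_coord N phi) (u, t) \in unitmx.
Proof.
move=> Uu ta; case: embed => _ /(_ U phi chart) jacu _.
by apply: jacu; split => //=; rewrite in_itv /= -ler_norml.
Qed.

Lemma layer_density_gt0 u t : U u -> `|t| <= a -> 0 < layer_density (u, t).
Proof.
move=> Uu ta; rewrite layer_densityE normr_gt0 -unitfE.
by have := layer_jac_unit Uu ta; rewrite unitmxE.
Qed.

Lemma layer_density_bounds e u t : U u -> second_form_norm N phi u <= e ->
  `|t| <= a -> `|layer_density (u, t) - layer_density (u, 0)| <=
    (2 * (a * e) + (a * e) ^+ 2) * layer_density (u, 0).
Proof.
move=> Uu; rewrite /second_form_norm.
set A := invmx _ *m _ => Ae ta.
have e0 : 0 <= e by apply: le_trans Ae; exact: sqrtr_ge0.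
have a0 : `|0 : R| <= a by rewrite normr0 ltW.
have d0 := layer_jac_unit Uu a0.
have [d ddef] : exists d : R -> R,
    forall s, \det (jac3 (layer_coord N phi) (u, s)) = d s.
  by exists (fun s => \det (jac3 (layer_coord N phi) (u, s))).
have pencil s : d s * d 0 = \det (first_form phi u - s *: second_form N phi u).
  by rewrite -!ddef; exact: (layer_density_pencil chart normalN s Uu).
have dN0 : d 0 != 0 by rewrite -unitfE -ddef -unitmxE.
have detI : \det (first_form phi u) = d 0 ^+ 2.
  by rewrite expr2 pencil scale0r subr0.
have detI_gt0 : 0 < \det (first_form phi u).
  by rewrite detI lt_neqAle sqr_ge0 andbT eq_sym sqrf_eq0.
have Iu : first_form phi u \in unitmx by rewrite unitmxE unitfE gt_eqF.
have IA : first_form phi u *m A = second_form N phi u by rewrite /A mulKVmx.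
have Isym : first_form phi u 1 0 = first_form phi u 0 1.
  by rewrite !mxE; apply: eq_bigr => k _; rewrite !mxE; exact: mulrC.
have Idiag i : 0 <= first_form phi u i i.
  by rewrite mxE; apply: sumr_ge0 => k _; rewrite !mxE -expr2 sqr_ge0.
have IIsym := second_form_sym N chart 1 0 Uu.
have trA : A 0 0 ^+ 2 + 2 * A 0 1 * A 1 0 + A 1 1 ^+ 2 <= e ^+ 2.
  have -> : A 0 0 ^+ 2 + 2 * A 0 1 * A 1 0 + A 1 1 ^+ 2 = \tr (A *m A).
    rewrite /mxtrace !big_ord_recl big_ord0 addr0.
    rewrite (_ : lift ord0 ord0 = 1 :> 'I_2); last exact/val_inj.
    by rewrite !mulmx2E; ring.
  have [tr0|tr0] := leP 0 (\tr (A *m A)).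
    by rewrite -[leLHS](sqr_sqrtr tr0) ler_pXn2r// nnegrE// sqrtr_ge0.
  by apply: le_trans (ltW tr0) _; exact: sqr_ge0.
have e00 := mulmx2E (first_form phi u) A 0 0.
have e01 := mulmx2E (first_form phi u) A 0 1.
have e10 := mulmx2E (first_form phi u) A 1 0.
have e11 := mulmx2E (first_form phi u) A 1 1.
rewrite IA ?Isym in e00 e01 e10 e11.
rewrite det_mx2 Isym in detI detI_gt0.
rewrite -expr2 in detI detI_gt0.
have disc : 0 <= (A 0 0 - A 1 1) ^+ 2 + 4 * A 0 1 * A 1 0.
  apply: trace_disc_ge0 (Idiag 0) (Idiag 1) detI_gt0 _.
  by rewrite -e01 -e10 IIsym.
have [T_le D_le] := trace_det_bounds e0 disc trA.
set T := A 0 0 + A 1 1 in T_le; set D := A 0 0 * A 1 1 - A 0 1 * A 1 0 in D_le.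
have dE : d t = d 0 * (1 - t * T + t ^+ 2 * D).
  apply: (mulIf dN0); rewrite pencil.
  rewrite det_mx2 !entry_subZ Isym IIsym -(expr2 (_ - _)).
  have := det_shape_pencil t (esym e00) (esym e01) _ (esym e11).
  rewrite -e10 IIsym => /(_ erefl) ->.
  by rewrite detI -/T -/D expr2 mulrAC.
have densE s : layer_density (u, s) = `|d s| by rewrite -ddef; exact: layer_densityE.
rewrite !densE dE normrM.
rewrite -[X in _ - X]mulr1 -mulrBr normrM normr_id mulrC ler_wpM2r//.
rewrite -[X in _ - X](@normr1 R) (le_trans (ler_dist_dist _ _))//.
have -> : 1 - t * T + t ^+ 2 * D - 1 = - (t * T) + t ^+ 2 * D by ring.
apply: (le_trans (ler_normD _ _)); rewrite normrN normrM [`|_ ^+ 2 * D|]normrM normrX; apply: lerD.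
  by rewrite mulrCA ler_pM.
by rewrite exprMn ler_pM// ?exprn_ge0// lerXn2r// nnegrE ltW.
Qed.

Lemma layer_density_continuous q : U q.1 -> {for q, continuous layer_density}.
Proof.
move=> Uq; rewrite (_ : layer_density = fun q => `|\det (jac3 (layer_coord N phi) q)|); last
  by apply/funext => y; exact: layer_densityE.
have [openU smooth_phi _ _ _] := chart.
have [smooth_N _] := normalN chart.
have nU : nbhs q [set y : R * R * R | U y.1].
  by apply: (@prod_fst_cvg _ _ q); exact: open_nbhs_nbhs.
pose J (y : R * R * R) : 'M[R]_3 :=
  col_mx (jac2 phi y.1 + y.2 *: jac2 (N \o phi) y.1) (N (phi y.1)) : 'M[R]_(2 + 1, 3).
have JE y : U y.1 -> jac3 (layer_coord N phi) y = J y.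
  case: y => y t /= Uy; apply: jac3_layer_coord => v.
    exact: smooth_on_derivable smooth_phi Uy.
  exact: smooth_on_derivable smooth_N Uy.
have coordc (F : R * R -> 'rV[R]_3) j : {for q.1, continuous F} ->
    {for q, continuous (fun y : R * R * R => F y.1 0 j)}.
  move=> Fc; apply: (@continuous_comp _ _ _ (fun y : R * R * R => F y.1) (fun M => M 0 j)).
    exact: cvg_comp (@prod_fst_cvg _ _ q) Fc.
  exact: coord_continuous.
have Jc i j : {for q, continuous (fun y => J y i j)}.
  case: (@splitP 2 1 i) => k ik.
    have -> : i = lshift 1 k by apply/val_inj.
    rewrite (_ : (fun y => _) = fun y => ('D_(basis2 k) phi y.1) 0 j +
        y.2 * ('D_(basis2 k) (N \o phi) y.1) 0 j); last first.
      by apply/funext => y; rewrite /J (@col_mxEu _ 2 1) !mxE.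
    apply: cvgD.
      apply: (coordc ('D_(basis2 k) phi)).
      exact: smooth_on_continuous (smooth_on_derive (basis2 k) smooth_phi) Uq.
    apply: cvgM; first exact: (@prod_snd_cvg _ _ q).
    apply: (coordc ('D_(basis2 k) (N \o phi))).
    exact: smooth_on_continuous (smooth_on_derive (basis2 k) smooth_N) Uq.
  have -> : i = rshift 2 k by apply/val_inj.
  rewrite (_ : (fun y => _) = fun y => (N \o phi) y.1 0 j); last first.
    by apply/funext => y; rewrite /J (@col_mxEd _ 2 1) (ord1 k).
  apply: (coordc (N \o phi)).
  exact: smooth_on_continuous smooth_N Uq.
have : `|\det (J y)| @[y --> q] --> `|\det (J q)| by apply: cvg_norm; exact: continuous_det.
rewrite -JE// => Jcv; rewrite /prop_for /continuous_at; apply: cvg_trans Jcv; apply: near_eq_cvg.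
by apply: filterS nU => y Uy; rewrite JE.
Qed.

End layer_density.

(** * Charts of the layer *)

Lemma open_setX (T1 T2 : topologicalType) (A : set T1) (B : set T2) :
  open A -> open B -> open (A `*` B).
Proof.
move=> oA oB; rewrite (_ : A `*` B = fst @^-1` A `&` snd @^-1` B)//.
apply: openI; apply: open_comp => // y _; [exact: prod_fst_cvg|exact: prod_snd_cvg].
Qed.

Lemma closed_setX (T1 T2 : topologicalType) (A : set T1) (B : set T2) :
  closed A -> closed B -> closed (A `*` B).
Proof.
move=> cA cB; rewrite (_ : A `*` B = fst @^-1` A `&` snd @^-1` B)//.
apply: closedI; apply: closed_comp => // y _; [exact: prod_fst_cvg|exact: prod_snd_cvg].
Qed.

Section layer_topology.
Context {R : realType}.
Variable S : set 'rV[R]_3.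

Lemma local_param_sub U U' phi : local_param S U phi -> open U' -> U' `<=` U ->
  local_param S U' phi.
Proof.
move=> [oU sU rU iU hU] oU' U'U; split => //.
- by move=> s x /U'U/sU; apply.
- by move=> u /U'U/rU.
- by move=> u v; rewrite !inE => /U'U uU /U'U vU; apply: iU; rewrite inE.
- by move=> W oW WU'; apply: hU => //; exact: subset_trans U'U.
Qed.

Lemma layer_chart_continuous U phi (q : R * R * R) : local_param S U phi -> U q.1 ->
  {for q, continuous (layer_chart phi)}.
Proof.
move=> [_ sU _ _ _] Uq.
have c1 : phi y.1 @[y --> q] --> phi q.1.
  exact: cvg_comp (@prod_fst_cvg _ _ q) (smooth_on_continuous sU Uq).
exact: (cvg_pair c1 (@prod_snd_cvg _ _ q)).
Qed.

Lemma open_chart_cylinder U phi : local_param S U phi -> open [set q : R * R * R | U q.1].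
Proof.
move=> [oU _ _ _ _]; rewrite openE => q Uq.
have nU : nbhs q.1 U by exact: open_nbhs_nbhs.
exact: (@prod_fst_cvg _ _ q U nU).
Qed.

Definition chart_continuous (h : 'rV[R]_3 * R -> R) :=
  forall U phi, local_param S U phi -> forall q : R * R * R, U q.1 ->
    {for q, continuous (h \o layer_chart phi)}.

Lemma chart_continuous_preimage (h : 'rV[R]_3 * R -> R) (O : set R) :
  embedded_surface S -> chart_continuous h -> open O ->
  exists2 G : set ('rV[R]_3 * R), open G & forall z, S z.1 -> G z <-> O (h z).
Proof.
move=> surfS hc oO.
exists (\bigcup_(G in [set G | open G /\ forall z, S z.1 -> G z -> O (h z)]) G).
  by apply: bigcup_open => G [].
move=> z Sz; split => [[G [_ GO] Gz]|Ohz]; first exact: GO.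
have [U [phi [chart [u Uu uz]]]] := surfS _ Sz.
have nO : nbhs (u, z.2) ((h \o layer_chart phi) @^-1` O).
  apply: (hc _ _ chart (u, z.2) Uu); apply: open_nbhs_nbhs; split => //=.
  by rewrite /layer_chart /= uz -surjective_pairing.
have [[W1 W2] /= [nW1 nW2] W12] := nO.
have [oU _ _ injphi hU] := chart.
pose W := W1^° `&` U.
have oW : open W by apply: openI => //; exact: open_interior.
have [V oV phiW] := hU W oW (@subIsetr _ _ _).
exists (V `*` W2^°).
  split; first by apply: open_setX => //; exact: open_interior.
  move=> [x t] /= Sx [/= Vx W2t].
  have [v [W1v Uv] vx] : (phi @` W) x by rewrite phiW.
  rewrite -vx; apply: (W12 (v, t)); split => /=; exact: interior_subset.
case: z Sz Ohz uz nW2 {nO W12} => x t /= Sx _ ux nW2; split => //=.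
have : (phi @` W) x by exists u.
by rewrite phiW => -[].
Qed.

Local Notation BX := (g_sigma_algebraType (@open ('rV[R]_3 * R)%type)).

Lemma chart_continuous_measurable (h : BX -> R) (A : set BX) :
  embedded_surface S -> chart_continuous h ->
  (forall z : 'rV[R]_3 * R, A z -> S z.1) -> measurable_fun A h.
Proof.
move=> surfS hc AS mA; apply: (measurability _ (RGenOpens.measurableE R)) => //.
move=> _ [_ [l [r ->] <-]].
have oI : open `]l, r[%classic by exact: interval_open.
have [G oG GO] := chart_continuous_preimage surfS hc oI.
have -> : A `&` h @^-1` `]l, r[%classic = A `&` G.
  by apply/seteqP; split => z [Az]; split => //; apply/(GO z (AS z Az)).
by apply: measurableI => //; exact: sub_sigma_algebra.
Qed.

Lemma chart_continuous_within (h : 'rV[R]_3 * R -> R) (A : set ('rV[R]_3 * R)) :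
  embedded_surface S -> chart_continuous h ->
  (forall z, A z -> S z.1) -> {within A, continuous h}.
Proof.
move=> surfS hc AS; apply/subspace_continuousP => z Az.
move=> B nB.
have [W [oW Whz WB]] : exists W : set R, [/\ open W, W (h z) & W `<=` B].
  by exists B^°; split; [exact: open_interior|exact: nB|exact: interior_subset].
have [G oG GO] := chart_continuous_preimage surfS hc oW.
have nG : nbhs z G by apply: open_nbhs_nbhs; split => //; apply/(GO z (AS z Az)).
apply: filterS nG => y Gy Ay /=; apply: WB; exact/(GO y (AS y Ay)).
Qed.

End layer_topology.

Section layer_charts.
Context {R : realType}.
Local Notation R2 := (measurableTypeR R * measurableTypeR R)%type.
Local Notation BX := (g_sigma_algebraType (@open ('rV[R]_3 * R)%type)).
Variables (S : set 'rV[R]_3) (N : 'rV[R]_3 -> 'rV[R]_3) (a : R).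
Variable mu : {measure set BX -> \bar R}.
Hypotheses (normalN : unit_normal_field S N) (a_gt0 : 0 < a).
Hypotheses (embed : layer_embedding S N a) (volume : layer_volume S N a mu).

Lemma measurable_chart_set U phi (B : set 'rV[R]_3) : local_param S U phi ->
  measurable (B `*` `[- a, a]%classic : set BX) ->
  measurable (U `&` phi @^-1` B : set R2).
Proof.
move=> chart mB.
have oC := open_chart_cylinder chart.
have mC := open_measurable3 oC.
have mpsi := @continuous_on_open_measurable_g_sigma R
  [set q : R * R * R | U q.1] (layer_chart phi) oC
  (fun q => @layer_chart_continuous R S U phi q chart).
have mD := mpsi mC _ mB.
have -> : U `&` phi @^-1` B = ysection ([set q : R * R * R | U q.1] `&`
    layer_chart phi @^-1` (B `*` `[- a, a]%classic)) 0.
  apply/seteqP; split => u; rewrite /ysection /=.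
    by move=> [Uu Bu]; rewrite inE; split => //; split => //=; rewrite in_itv /= oppr_le0 ltW.
  by rewrite inE => -[Uu [Bu _]].
exact: (@measurable_ysection _ _ R2 (measurableTypeR R)).
Qed.

Lemma measurable_layer_density U phi (E : set R2) : local_param S U phi ->
  measurable E -> E `<=` U -> measurable_fun (E `*` `[- a, a]%classic) (layer_density N phi).
Proof.
move=> chart mE EU.
apply: (@measurable_funS _ _ _ _ [set q : R * R * R | U q.1]).
- exact: (open_measurable3 (open_chart_cylinder chart)).
- by move=> q [/= + _]; exact: EU.
apply: continuous_on_open_measurable3; first exact: (open_chart_cylinder chart).
by move=> q Uq; exact: layer_density_continuous chart normalN _ Uq.
Qed.

Lemma integral_layer_chart U phi (B : set 'rV[R]_3) (h : BX -> R) :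
  local_param S U phi -> B `<=` phi @` U ->
  measurable (B `*` `[- a, a]%classic : set BX) ->
  measurable_fun (B `*` `[- a, a]%classic : set BX) h -> (forall z, 0 <= h z) ->
  (\int[mu]_(z in (B `*` `[(- a)%R, a]%classic : set BX)) (h z)%:E =
   \int[@lebesgue3 R]_(q in (U `&` phi @^-1` B) `*` `[(- a)%R, a]%classic)
      ((h (layer_chart phi q))%:E * (layer_density N phi q)%:E))%E.
Proof.
move=> chart BU mB mh h0.
have mE := measurable_chart_set chart mB.
have mD := measurableX mE (measurable_itv `[- a, a]).
apply: (@ge0_integral_image_density _ _ _ _ R
  ((@lebesgue_measure R \x @lebesgue_measure R) \x @lebesgue_measure R)%E mu
  (layer_chart phi) _ _ _ mD mB) => //.
- by move=> q [[_ Bq] Iq]; split.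
- apply: (@measurable_funS _ _ _ _ [set q : R * R * R | U q.1]).
  + exact: (open_measurable3 (open_chart_cylinder chart)).
  + by move=> q [[+ _] _]; exact.
  apply: continuous_on_open_measurable_g_sigma; first exact: (open_chart_cylinder chart).
  by move=> q Uq; exact: (layer_chart_continuous chart Uq).
- exact: (measurable_layer_density chart mE (@subIsetl _ _ _)).
- by move=> q _; exact: sqrtr_ge0.
- move=> F mF FB; rewrite (volume chart mF).
    congr (integral _ _ _); apply/seteqP; split => q.
      move=> [[Uq Iq] Fq]; split => //; split => //; split => //.
      by have [] := FB _ Fq.
    by move=> [[[Uq Bq] Iq] Fq].
  move=> z /FB[/= Bz Iz]; have [u Uu uz] := BU _ Bz.
  by exists (u, z.2) => //; rewrite /layer_chart /= uz -surjective_pairing.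
- exact/measurable_EFinP.
- by move=> z _; rewrite lee_fin.
Qed.

End layer_charts.

Section test_functions.
Context {R : realType}.
Variables (S : set 'rV[R]_3) (a : R) (K : set ('rV[R]_3 * R)).
Variables (f : 'rV[R]_3 * R -> R).
Hypotheses (surfS : embedded_surface S) (test : test_function S a K f).

Definition fiber_derive (z : 'rV[R]_3 * R) : R := 'D_1 (fun s : R => f (z.1, s)) z.2.

Let supp := closure [set z | f z != 0].

Let f_eq0 z : ~ supp z -> f z = 0.
Proof. by move=> nz; apply/eqP/negPn/negP => fz; apply: nz; exact: subset_closure. Qed.

Lemma test_support_bound : exists b, [/\ 0 < b, b < a &
  forall x t, b <= `|t| -> f (x, t) = 0].
Proof.
have [_ cs sub [z0 z0f]] := test.
have [c] : exists2 c, c \in supp & forall z, z \in supp -> `|z.2| <= `|c.2|.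
  apply: (@compact_EVT_max _ _ (fun z : 'rV[R]_3 * R => `|z.2|)) => //.
    by exists z0; exact: subset_closure.
  apply: continuous_subspaceT => z.
  by apply: cvg_norm; exact: (@prod_snd_cvg _ _ z).
rewrite inE => /sub[[_ /=]]; rewrite in_itv /= -ltr_norml => ca _ cmax.
have c0 := normr_ge0 c.2.
exists ((`|c.2| + a) / 2); split; [lra|lra|move=> x t bt].
apply: f_eq0 => xt; have := cmax (x, t); rewrite inE => /(_ xt) /= tc.
lra.
Qed.

Section chart.
Variables (U : set (R * R)) (phi : R * R -> 'rV[R]_3).
Hypothesis chart : local_param S U phi.

Let off_support : set (R * R * R) :=
  [set q | U q.1] `&` layer_chart phi @^-1` (~` supp).

Let open_off_support : open off_support.
Proof.
rewrite openE => q [Uq nq]; apply: filterI.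
  by apply: open_nbhs_nbhs; split => //; exact: open_chart_cylinder chart.
apply: (layer_chart_continuous chart Uq); apply: open_nbhs_nbhs; split => //.
by apply: closed_openC; exact: closed_closure.
Qed.

Lemma test_chart q : U q.1 -> [/\ {for q, continuous (f \o layer_chart phi)},
  derivable (f \o layer_chart phi) q (basis3 2) &
  {for q, continuous ('D_(basis3 2) (f \o layer_chart phi))}].
Proof.
move=> Uq; have [smoothf _ sub _] := test.
have [sq|nq] := pselect (supp (layer_chart phi q)).
  have Iq : (U `*` `]- a, a[) q by have [[_ ?] _] := sub _ sq; split.
  have sf := smoothf U phi chart.
  split; [exact: smooth_on_continuous sf Iq|exact: smooth_on_derivable sf Iq|].
  exact: smooth_on_continuous (smooth_on_derive (basis3 2) sf) Iq.
have oq : off_support q by split.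
have nq' : nbhs q off_support by exact: open_nbhs_nbhs.
have f0 y : off_support y -> (f \o layer_chart phi) y = 0.
  by move=> [_ ny]; exact: f_eq0.
have near_cst (F : R * R * R -> R) : (forall y, off_support y -> F y = 0) ->
    {for q, continuous F}.
  move=> F0; have : cst (0 : R) y @[y --> q] --> (0 : R) by exact: cvg_cst.
  rewrite /prop_for /continuous_at (F0 _ oq) => c0; apply: cvg_trans c0.
  by apply: near_eq_cvg; apply: filterS nq' => y oy; rewrite F0.
split; first exact: near_cst.
  apply: (@near_eq_derivable _ _ _ (cst 0)); last exact: derivable_cst.
  by apply: filterS nq' => y oy; rewrite f0.
apply: near_cst => y oy.
exact: (@derive_eq0_on_open R _ _ off_support _ (0 : R) y (basis3 2) open_off_support oy f0).
Qed.

Let fiber_line u (h t : R) : (fun s : R => (u, s)) (h *: (1 : R) + t) =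
  h *: @basis3 R 2 + (fun s : R => (u, s)) t.
Proof.
rewrite /= /basis3 /=; congr (_, _).
by rewrite [X in _ = X + _](_ : _ = 0) ?add0r//; congr (_, _); exact: mulr0.
Qed.

Lemma fiber_derive_chart q :
  fiber_derive (layer_chart phi q) = 'D_(basis3 2) (f \o layer_chart phi) q.
Proof.
rewrite /fiber_derive /=.
have := @derive_along R _ _ _ (f \o layer_chart phi) (fun s : R => (q.1, s)) q.2 1
  (basis3 2) (fun h => fiber_line q.1 h q.2).
by rewrite -surjective_pairing.
Qed.

Lemma derivable_fiber u t : U u -> derivable (fun s : R => f (phi u, s)) t 1.
Proof.
move=> Uu; have [_ df _] := @test_chart (u, t) Uu.
exact/(@derivable_along R _ _ _ (f \o layer_chart phi) (fun s : R => (u, s)) t 1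
  (basis3 2) (fun h => fiber_line u h t)).
Qed.

Lemma continuous_fiber_derive u : U u -> continuous ('D_1 (fun s : R => f (phi u, s))).
Proof.
move=> Uu t; have [_ _ cf] := @test_chart (u, t) Uu.
have E s : 'D_1 (fun s : R => f (phi u, s)) s =
    'D_(basis3 2) (f \o layer_chart phi) (u, s).
  exact: (fiber_derive_chart (u, s)).
have c1 : (fun s : R => (u, s)) s @[s --> t] --> (u, t).
  have cu : cst u s @[s --> t] --> u by exact: cvg_cst.
  have ct : id s @[s --> t] --> t by exact: cvg_id.
  exact: (cvg_pair cu ct).
have c2 : 'D_(basis3 2) (f \o layer_chart phi) (u, s) @[s --> t] -->
    'D_(basis3 2) (f \o layer_chart phi) (u, t) by exact: cvg_comp c1 cf.
rewrite /continuous_at -E in c2; apply: cvg_trans c2; apply: near_eq_cvg.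
by near=> s; rewrite E.
Unshelve. all: by end_near. Qed.

End chart.

Lemma chart_continuous_test : chart_continuous S f.
Proof. by move=> U phi chart q Uq; have [] := test_chart chart Uq. Qed.

Lemma chart_continuous_fiber_derive : chart_continuous S fiber_derive.
Proof.
move=> U phi chart q Uq; have [_ _ cf] := test_chart chart Uq.
rewrite (_ : _ \o _ = 'D_(basis3 2) (f \o layer_chart phi))//.
by apply/funext => y; rewrite /= -fiber_derive_chart.
Qed.

Lemma test_bounded : exists2 M, 0 <= M & forall z, f z ^+ 2 <= M.
Proof.
have [_ cs sub _] := test.
have : {within supp, continuous f}.
  apply: (chart_continuous_within surfS chart_continuous_test) => z /sub[[]//].
move=> /continuous_compact/(_ cs)/compact_bounded[M [_ Mb]].
have M1 : M < `|M| + 1 by rewrite ltr_pwDr// ler_norm.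
exists ((`|M| + 1) ^+ 2); first exact: sqr_ge0.
move=> z; have [sz|nz] := pselect (supp z); last by rewrite f_eq0// expr0n sqr_ge0.
have M10 : 0 <= `|M| + 1 by rewrite addr_ge0.
rewrite -(@real_normK _ (f z)) ?num_real//; apply: lerXn2r; rewrite ?nnegrE//.
by apply: (Mb _ M1); exists z.
Qed.

End test_functions.

Section local_bounds.
Context {R : realType}.
Local Notation BX := (g_sigma_algebraType (@open ('rV[R]_3 * R)%type)).
Local Notation R3 := (measurableTypeR R * measurableTypeR R * measurableTypeR R)%type.
Local Notation leb3 :=
  ((@lebesgue_measure R \x @lebesgue_measure R) \x @lebesgue_measure R)%E.
Variables (S : set 'rV[R]_3) (N : 'rV[R]_3 -> 'rV[R]_3) (a : R).
Variable mu : {measure set BX -> \bar R}.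
Hypotheses (surfS : embedded_surface S) (normalN : unit_normal_field S N).
Hypotheses (a_gt0 : 0 < a) (volume : layer_volume S N a mu).
Variables (K : set ('rV[R]_3 * R)) (f : 'rV[R]_3 * R -> R).
Hypothesis test : test_function S a K f.

Local Notation sqr_int h B :=
  (\int[mu]_(z in (B `*` `[(- a)%R, a]%classic : set BX)) (h z ^+ 2)%:E)%E.

Lemma measurable_sqr_chart_continuous (h : BX -> R) (B : set 'rV[R]_3) :
  chart_continuous S h -> B `<=` S ->
  measurable_fun (B `*` `[- a, a]%classic : set BX) (fun z => h z ^+ 2).
Proof.
move=> hc BS; apply: measurable_funX.
by apply: (chart_continuous_measurable surfS hc) => z [/BS].
Qed.

Section chart.
Variables (U : set (R * R)) (phi : R * R -> 'rV[R]_3) (B : set 'rV[R]_3).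
Hypotheses (chart : local_param S U phi) (BU : B `<=` phi @` U) (BS : B `<=` S).
Hypothesis mB : measurable (B `*` `[- a, a]%classic : set BX).

Let E := U `&` phi @^-1` B.
Let mE : measurable (E : set (measurableTypeR R * measurableTypeR R)).
Proof. exact: (measurable_chart_set a_gt0 chart mB). Qed.
Let mI : measurable (`[- a, a]%classic : set (measurableTypeR R)).
Proof. exact: measurable_itv. Qed.
Let mEI : measurable (E `*` `[- a, a]%classic : set R3).
Proof. exact: measurableX. Qed.
Let mw : measurable_fun (E `*` `[- a, a]%classic : set R3) (layer_density N phi).
Proof. exact: (measurable_layer_density normalN chart mE (@subIsetl _ _ _)). Qed.

Lemma sqr_int_chart (h : BX -> R) : chart_continuous S h ->
  sqr_int h B = (\int[@lebesgue3 R]_(q in (E `*` `[(- a)%R, a]%classic : set R3))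
    ((h (layer_chart phi q) ^+ 2)%:E * (layer_density N phi q)%:E))%E.
Proof.
move=> hc; apply: (integral_layer_chart normalN a_gt0 volume chart BU mB).
  exact: measurable_sqr_chart_continuous.
by move=> z; exact: sqr_ge0.
Qed.

Let mh (h : BX -> R) : chart_continuous S h ->
  measurable_fun (E `*` `[- a, a]%classic : set R3)
    (fun q => (h (layer_chart phi q) ^+ 2)%:E * (layer_density N phi q)%:E)%E.
Proof.
move=> hc; apply: emeasurable_funM; last exact/measurable_EFinP.
apply/measurable_EFinP; apply: measurable_funX.
apply: (@measurable_funS _ _ _ _ [set q : R * R * R | U q.1]).
- exact: (open_measurable3 (open_chart_cylinder chart)).
- by move=> q [[+ _] _]; exact.
apply: continuous_on_open_measurable3; first exact: (open_chart_cylinder chart).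
by move=> q Uq; exact: (hc U phi chart q Uq).
Qed.

Let integrand_ge0 (h : BX -> R) q :
  (0 <= (h (layer_chart phi q) ^+ 2)%:E * (layer_density N phi q)%:E)%E.
Proof. by rewrite -EFinM lee_fin mulr_ge0 ?sqr_ge0// sqrtr_ge0. Qed.

Lemma local_fiber_bound (d : R) : 0 <= d -> d <= 1 ->
  (forall u t, U u -> `|t| <= a ->
    `|layer_density N phi (u, t) - layer_density N phi (u, 0)| <=
      d * layer_density N phi (u, 0)) ->
  (((1 - d) * (pi / (2 * a)) ^+ 2)%:E * sqr_int f B <=
   (1 + d)%:E * sqr_int (fiber_derive f) B)%E.
Proof.
move=> d0 d1 wd.
have fc := chart_continuous_test test.
have fdc := chart_continuous_fiber_derive test.
rewrite (sqr_int_chart fc) (sqr_int_chart fdc).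
have c1 : 0 <= 1 - d by rewrite subr_ge0.
have c2 : 0 <= 1 + d by rewrite addr_ge0.
have k0 : 0 <= (1 - d) * (pi / (2 * a)) ^+ 2 by rewrite mulr_ge0 ?sqr_ge0.
have scale (c : R) (h : BX -> R) : 0 <= c -> chart_continuous S h ->
   (c%:E * \int[@lebesgue3 R]_(q in (E `*` `[(- a)%R, a]%classic : set R3))
    ((h (layer_chart phi q) ^+ 2)%:E * (layer_density N phi q)%:E) =
   \int[leb3]_(q in
      (E `*` `[(- a)%R, a]%classic : set R3))
    (c%:E * ((h (layer_chart phi q) ^+ 2)%:E * (layer_density N phi q)%:E)))%E.
  by move=> ? hc; rewrite ge0_integralZl_EFin//; exact: mh.
rewrite (scale _ f k0 fc) (scale _ (fiber_derive f) c2 fdc).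
have mc (c : R) h : chart_continuous S h -> measurable_fun (E `*` `[- a, a]%classic : set R3)
    (fun q => c%:E * ((h (layer_chart phi q) ^+ 2)%:E * (layer_density N phi q)%:E))%E.
  by move=> hc; apply: emeasurable_funM; [exact: measurable_cst|exact: (mh hc)].
have ge0 (c : R) h q : 0 <= c -> (0 <=
    c%:E * ((h (layer_chart phi q) ^+ 2)%:E * (layer_density N phi q)%:E))%E.
  by move=> ?; rewrite mule_ge0// lee_fin.
apply: (@ge0_le_integral_setX _ _ _ _ _ (@lebesgue_measure2 R) (@lebesgue_measure R) _ _ _ _
  mE mI (mc _ f fc) (mc _ (fiber_derive f) fdc)
  (fun q _ => ge0 _ f q k0) (fun q _ => ge0 _ (fiber_derive f) q c2)).
move=> u [Uu Bu].
have [b [b0 ba fb]] := test_support_bound test.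
have H1 t : derivable (fun s => f (phi u, s)) t 1 by exact: (derivable_fiber test chart).
have H2 : continuous ('D_1 (fun s => f (phi u, s))).
  exact: (continuous_fiber_derive test chart Uu).
have H3 : 0 <= layer_density N phi (u, 0) by exact: sqrtr_ge0.
have H4 : measurable_fun `[- a, a] (fun s => layer_density N phi (u, s)).
  apply: (measurable_comp mEI _ mw (measurable_funTS
    (pair1_measurable (u : measurableTypeR R * measurableTypeR R)))).
  by move=> _ [t It <-]; split.
have H5 t : `|t| <= a -> (1 - d) * layer_density N phi (u, 0) <=
    layer_density N phi (u, t) <= (1 + d) * layer_density N phi (u, 0).
  move=> ta; have := wd u t Uu ta; rewrite ler_distl => /andP[w1 w2].
  by rewrite mulrBl mul1r w1 mulrDl mul1r w2.
exact: (weighted_poincare_itv b0 ba H1 H2 (fb (phi u)) H3 c1 c2 H4 H5).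
Qed.

Lemma local_sqr_int_lty (M W r : R) (u0 : R * R) : 0 <= W -> U `<=` ball u0 r ->
  (forall z, f z ^+ 2 <= M) ->
  (forall u t, U u -> `|t| <= a -> layer_density N phi (u, t) <= W) ->
  (sqr_int f B < +oo)%E.
Proof.
move=> W0 Ur fM wW; have fc := chart_continuous_test test.
rewrite (sqr_int_chart fc).
pose Q : set R3 := (`[u0.1 - r, u0.1 + r]%classic `*` `[u0.2 - r, u0.2 + r]%classic)
  `*` `[- a, a]%classic.
have mQ : measurable Q.
  by apply: measurableX; [apply: measurableX|]; exact: measurable_itv.
have M0 : 0 <= M by apply: le_trans (fM 0); exact: sqr_ge0.
apply: (@le_lt_trans _ _ ((M * W)%:E *
  leb3 Q)%E).
  rewrite -integral_cst//.
  apply: (@le_trans _ _ (\int[leb3]_(q in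
      (E `*` `[(- a)%R, a]%classic : set R3)) (cst (M * W)%:E q))%E).
    apply: ge0_le_integral => //; first exact: (mh fc).
    move=> [u t] [[/= Uu _]]; rewrite in_itv /= -ler_norml => ta.
    by rewrite -EFinM lee_fin ler_pM ?sqr_ge0 ?sqrtr_ge0// wW.
  apply: ge0_subset_integral => //.
    by move=> q _; rewrite lee_fin mulr_ge0.
  move=> [[x y] t] [[/= Uu _] It]; split => //=.
  have [/= xr yr] := Ur _ Uu.
  move: xr yr; rewrite -!ball_normE /= => xr yr.
  by split; rewrite /= in_itv /= -ler_distlC ltW.
have finI (x y : R) : (@lebesgue_measure R `[x, y]%classic < +oo)%E.
  rewrite [X in (X < _)%E](lebesgue_measure_itv `[x, y]) /=.
  by case: ifP => _; rewrite ?ltry.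
have finI' (x y : R) : @lebesgue_measure R `[x, y]%classic \is a fin_num.
  by rewrite ge0_fin_numE.
rewrite [X in (_ * X)%E]lebesgue_measure_box; try exact: measurable_itv.
by apply: lte_mul_pinfty; rewrite ?lee_fin ?mulr_ge0// lte_mul_pinfty ?mule_ge0// fin_numM.
Qed.

Lemma local_sqr_int_gt0 (u0 : R * R) (t0 : R) : layer_embedding S N a -> U u0 ->
  (forall u t, U u -> f (phi u, t) != 0 -> B (phi u)) -> f (phi u0, t0) != 0 ->
  (0 < sqr_int f B)%E.
Proof.
move=> embed Uu0 fB f0; have fc := chart_continuous_test test.
rewrite (sqr_int_chart fc).
have [b [b0 ba fb]] := test_support_bound test.
have ta : `|t0| < a.
  by apply: lt_trans ba; rewrite ltNge; apply/negP => /(fb (phi u0))/eqP; exact/negP.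
pose g (q : R * R * R) := f (layer_chart phi q) ^+ 2 * layer_density N phi q.
have gc : {for (u0, t0), continuous g}.
  apply: cvgM; last exact: (@layer_density_continuous _ _ _ _ _ chart normalN (u0, t0) Uu0).
  exact: continuous_sqr (fc U phi chart (u0, t0) Uu0).
have g0 : 0 < g (u0, t0).
  apply: mulr_gt0; first by rewrite exprn_even_gt0.
  by apply: (layer_density_gt0 chart embed) => //; exact: ltW.
have nU : nbhs (u0, t0) [set q : R * R * R | U q.1].
  by apply: open_nbhs_nbhs; split => //; exact: (open_chart_cylinder chart).
have nf : nbhs (u0, t0) [set q : R * R * R | g (u0, t0) / 2 < g q].
  have nr : nbhs (g (u0, t0)) [set s | g (u0, t0) / 2 < s].
    by apply: open_nbhs_nbhs; split; [exact: open_gt|rewrite /=; lra].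
  exact: (gc _ nr).
have nI : nbhs (u0, t0) [set q : R * R * R | `|q.2| < a].
  have nr : nbhs t0 [set s : R | `|s| < a].
    have nr' : nbhs t0 `]- a, a[%classic.
      by apply: open_nbhs_nbhs; split; [exact: interval_open|rewrite /= in_itv /= -ltr_norml].
    by apply: filterS nr' => s /=; rewrite in_itv /= -ltr_norml.
  exact: (@prod_snd_cvg _ _ (u0, t0) _ nr).
have nP : nbhs (u0, t0) ([set q : R * R * R | U q.1] `&`
    ([set q | g (u0, t0) / 2 < g q] `&` [set q | `|q.2| < a])).
  by apply: filterI => //; exact: filterI.
have [r /= r0 rP] := (nbhs_ballP _ _).1 nP.
pose Q : set R3 := (`[u0.1 - r / 2, u0.1 + r / 2]%classic `*`
  `[u0.2 - r / 2, u0.2 + r / 2]%classic) `*` `[t0 - r / 2, t0 + r / 2]%classic.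
have mQ : measurable Q.
  by apply: measurableX; [apply: measurableX|]; exact: measurable_itv.
have QP q : Q q -> [/\ U q.1, g (u0, t0) / 2 < g q & `|q.2| < a].
  case: q => [[x y] t] [[/= + +] +]; rewrite !in_itv /= -!ler_distlC => xr yr tr.
  have [] := rP ((x, y), t) _; last by move=> ? [].
  have r2 : r / 2 < r by lra.
  by split; [split|] => /=; rewrite -ball_normE /=; [apply: le_lt_trans xr _|apply: le_lt_trans yr _|apply: le_lt_trans tr _].
apply: (@lt_le_trans _ _ ((g (u0, t0) / 2)%:E *
  leb3 Q)%E).
  have lt_r (x : R) : x - r / 2 < x + r / 2 by lra.
  rewrite [X in (_ * X)%E]lebesgue_measure_box; try exact: measurable_itv.
  rewrite !lebesgue_measure_cc ?ltW// -!EFinM lte_fin.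
  have pos (x : R) : 0 < x + r / 2 - (x - r / 2) by lra.
  by apply: mulr_gt0; [exact: divr_gt0|rewrite !mulr_gt0 ?pos].
rewrite -integral_cst//.
have QE : Q `<=` E `*` `[- a, a]%classic.
  move=> q Qq; have [Uq gq qa] := QP _ Qq; split; last first.
    by rewrite /= in_itv /= -ler_norml ltW.
  split => //; apply: (fB q.1 q.2 Uq); apply: contraTneq gq => fq.
  by rewrite /g /layer_chart fq expr0n /= mul0r -leNgt divr_ge0// ltW.
apply: (@le_trans _ _ (\int[leb3]_(q in Q)
    ((f (layer_chart phi q) ^+ 2)%:E * (layer_density N phi q)%:E))%E).
  have c0 q : Q q -> (0 <= cst (g (u0, t0) / 2)%:E q)%E.
    by move=> _; rewrite lee_fin divr_ge0// ltW.
  have le_c q : Q q -> (cst (g (u0, t0) / 2)%:E q <=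
      (f (layer_chart phi q) ^+ 2)%:E * (layer_density N phi q)%:E)%E.
    by move=> Qq; have [_ gq _] := QP _ Qq; rewrite -EFinM lee_fin; exact: ltW gq.
  apply: (@ge0_le_integral _ R3 R leb3
    Q mQ (cst (g (u0, t0) / 2)%:E) (fun q => (f (layer_chart phi q) ^+ 2)%:E * (layer_density N phi q)%:E)%E
    c0 _ _ le_c); first exact: measurable_cst.
  exact: (measurable_funS mEI QE (mh fc)).
exact: (@ge0_subset_integral _ R3 R leb3
  Q _ mQ mEI _ (mh fc) (fun q _ => integrand_ge0 f q) QE).
Qed.

End chart.

End local_bounds.

(** * Lower bound on the Rayleigh quotient *)

Lemma ge0_le_integral_nonmeasurable d (T : measurableType d) (R : realType)
    (mu : {measure set T -> \bar R}) (f g : T -> \bar R) :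
  (forall x, 0 <= f x)%E -> (forall x, f x <= g x)%E ->
  (\int[mu]_x f x <= \int[mu]_x g x)%E.
Proof.
move=> f0 fg; have g0 x : (0 <= g x)%E by exact: le_trans (fg x).
rewrite !ge0_integralTE//; apply: le_ereal_sup => _ [h hf <-].
by exists h => // x; exact: le_trans (fg x).
Qed.

Section layer_bounds.
Context {R : realType}.
Local Notation BX := (g_sigma_algebraType (@open ('rV[R]_3 * R)%type)).
Variables (S : set 'rV[R]_3) (N : 'rV[R]_3 -> 'rV[R]_3) (a : R).
Variable mu : {measure set BX -> \bar R}.
Hypotheses (surfS : embedded_surface S) (normalN : unit_normal_field S N).
Hypotheses (a_gt0 : 0 < a) (volume : layer_volume S N a mu).
Hypothesis embed : layer_embedding S N a.
Variables (K : set ('rV[R]_3 * R)) (f : 'rV[R]_3 * R -> R).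
Hypothesis test : test_function S a K f.

Local Notation sqr_int h B :=
  (\int[mu]_(z in (B `*` `[(- a)%R, a]%classic : set BX)) (h z ^+ 2)%:E)%E.

Lemma fiber_derive_le_grad z : layer S a z -> fiber_derive f z ^+ 2 <= grad_normsq S N f z.
Proof.
move=> [Sz Iz]; rewrite /grad_normsq.
set P := [set r | _].
have [U [phi [q [chart Uq qz ->]]]] : P (xget 0 P).
  apply: xgetPex; have [U [phi [chart [u Uu uz]]]] := surfS Sz.
  eexists; exists U, phi, (u, z.2); split => //.
  by rewrite /layer_chart /= uz -surjective_pairing.
have -> : fiber_derive f z = layer_diff phi f q 0 2.
  by rewrite -qz mxE; exact: fiber_derive_chart.
have [_ sphi _ _ _] := chart; have [sN N1] := normalN chart.
case: q Uq qz => u t /= Uu qz.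
apply: pullback_metric_ge.
  apply: (layer_jac_unit chart embed Uu).
  by move: Iz; rewrite -qz /= in_itv /= -ler_norml.
rewrite (jac3_layer_coord t (fun v => smooth_on_derivable (v := v) sphi Uu)
  (fun v => smooth_on_derivable (v := v) sN Uu)).
have [/enorm_eq1 NN _] := N1 u Uu.
rewrite (_ : row 2 _ = N (phi u))//; apply/rowP => j; rewrite mxE.
by rewrite (_ : 2 = rshift 2 0) ?(@col_mxEd _ 2 1)//; exact/val_inj.
Qed.

Lemma measurable_compact_layer (P : set 'rV[R]_3) : compact P ->
  measurable (P `*` `[- a, a]%classic : set BX).
Proof.
move=> cP; rewrite -[X in measurable X]setCK; apply: measurableC.
apply: sub_sigma_algebra; apply: closed_openC; apply: closed_setX.
  by apply: compact_closed => //; exact: norm_hausdorff.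
exact: itv_closed.
Qed.

Lemma measurable_open_layer (B V : set 'rV[R]_3) : open V ->
  measurable (B `*` `[- a, a]%classic : set BX) ->
  measurable ((B `&` V) `*` `[- a, a]%classic : set BX).
Proof.
move=> oV mB.
have -> : (B `&` V) `*` `[- a, a]%classic = (B `*` `[- a, a]%classic) `&` (V `*` setT).
  by rewrite -setXI setIT.
apply: measurableI => //; apply: sub_sigma_algebra; apply: open_setX => //.
exact: openT.
Qed.

Section fiber_bound.
Variables c1 c2 : R.

Definition fiber_bound (B : set 'rV[R]_3) :=
  (c1%:E * sqr_int f B <= c2%:E * sqr_int (fiber_derive f) B)%E /\
  (sqr_int f B < +oo)%E.

Lemma fiber_bound_cover (V : 'rV[R]_3 -> set 'rV[R]_3) (s : seq 'rV[R]_3)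
    (B : set 'rV[R]_3) : 0 <= c1 -> 0 <= c2 ->
  (forall x, x \in s -> open (V x) /\ forall B, B `<=` S `&` V x ->
     measurable (B `*` `[- a, a]%classic : set BX) -> fiber_bound B) ->
  B `<=` S -> measurable (B `*` `[- a, a]%classic : set BX) ->
  (forall y, B y -> exists2 x, x \in s & V x y) -> fiber_bound B.
Proof.
move=> c10 c20; elim: s B => [|x s IH] B Vs BS mB Bs.
  rewrite /fiber_bound (_ : B `*` _ = set0) ?integral_set0 ?mule0 ?ltry//.
  by apply/seteqP; split => // y [/Bs[]].
have [oV Vx] := Vs x (mem_head _ _).
have mB1 := measurable_open_layer oV mB.
have B2E : (B `\` V x) `*` `[- a, a]%classic =
    (B `*` `[- a, a]%classic) `\` ((B `&` V x) `*` `[- a, a]%classic).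
  apply/seteqP; split => [[y t] [[By nVy] It]|[y t] [[By It] nB1]].
    by split => // -[[]].
  by split => //; split => // Vy; apply: nB1.
have mB2 : measurable ((B `\` V x) `*` `[- a, a]%classic : set BX).
  by rewrite B2E; exact: measurableD.
have [ineq1 fin1] : fiber_bound (B `&` V x).
  by apply: Vx => // y [By Vy]; split => //; exact: BS.
have [ineq2 fin2] : fiber_bound (B `\` V x).
  apply: IH => //.
  - by move=> y ys; apply: Vs; rewrite inE ys orbT.
  - by move=> y [By _]; exact: BS.
  - move=> y [By nVy]; have [x'] := Bs _ By.
    by rewrite inE => /orP[/eqP -> //|? ?]; exists x'.
have BE : B `*` `[- a, a]%classic =
    ((B `&` V x) `*` `[- a, a]%classic) `|` ((B `\` V x) `*` `[- a, a]%classic).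
  by rewrite B2E setDUK// => -[y t] [[By _] It]; split.
have split_int (h : BX -> R) : chart_continuous S h ->
    sqr_int h B = (sqr_int h (B `&` V x) + sqr_int h (B `\` V x))%E.
  move=> hc; rewrite {1}BE; apply: ge0_integral_setU => //.
  - rewrite -BE; apply/measurable_EFinP.
    exact: (measurable_sqr_chart_continuous surfS hc BS).
  - by move=> z _; rewrite lee_fin sqr_ge0.
  - by rewrite B2E disj_set2E setDIK.
have pos (h : BX -> R) (A : set 'rV[R]_3) : (0 <= sqr_int h A)%E.
  by apply: integral_ge0 => z _; rewrite lee_fin sqr_ge0.
rewrite /fiber_bound (split_int _ (chart_continuous_test test)).
rewrite (split_int _ (chart_continuous_fiber_derive test)).
split; last exact: lte_add_pinfty.
rewrite (ge0_muleDr c1%:E (pos _ _) (pos _ _)) (ge0_muleDr c2%:E (pos _ _) (pos _ _)).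
exact: (leeD ineq1 ineq2).
Qed.

End fiber_bound.

Definition test_projection : set 'rV[R]_3 := fst @` closure [set z | f z != 0].

Lemma compact_test_projection : compact test_projection.
Proof.
have [_ cs _ _] := test; apply: continuous_compact => //.
by apply: continuous_subspaceT => z; exact: (@prod_fst_cvg _ _ z).
Qed.

Lemma test_projection_sub : test_projection `<=` S.
Proof. by have [_ _ sub _] := test; move=> _ [z /sub[[Sz _] _] <-]. Qed.

Lemma test_eq0 z : ~ test_projection z.1 -> f z = 0.
Proof.
move=> nz; apply/eqP/negPn/negP => fz; apply: nz; exists z => //.
exact: subset_closure.
Qed.

Lemma integral_layer_sqr : (\int[mu]_(z in layer S a) (f z ^+ 2)%:E =
  sqr_int f test_projection)%E.
Proof.
rewrite [LHS]integral_mkcond [RHS]integral_mkcond; congr (integral _ _).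
apply/funext => z; rewrite !patchE.
case: ifPn => [/set_mem[Sz Iz]|/negP nz]; case: ifPn => [/set_mem[Pz Iz']|/negP nz'] //.
  rewrite test_eq0 ?expr0n// => Pz; apply: nz'; exact/mem_set.
by exfalso; apply: nz; apply/mem_set; split => //; exact: test_projection_sub.
Qed.

Lemma integral_layer_grad : (sqr_int (fiber_derive f) test_projection <=
  \int[mu]_(z in layer S a) (grad_normsq S N f z)%:E)%E.
Proof.
rewrite [leLHS]integral_mkcond [leRHS]integral_mkcond.
apply: ge0_le_integral_nonmeasurable => z.
  by apply: erestrict_ge0 => y _; rewrite lee_fin sqr_ge0.
rewrite !patchE.
case: ifPn => [/set_mem[Pz Iz]|_]; case: ifPn => [/set_mem lz|/negP nz] //.
- by rewrite lee_fin fiber_derive_le_grad.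
- by exfalso; apply: nz; apply/mem_set; split => //; exact: test_projection_sub.
- by rewrite lee_fin; apply: le_trans (fiber_derive_le_grad lz); exact: sqr_ge0.
Qed.

Lemma test_sqr_int_gt0 : (0 < sqr_int f test_projection)%E.
Proof.
have mP := measurable_compact_layer compact_test_projection.
have [_ _ sub [z fz]] := test.
have Pz : test_projection z.1 by exists z => //; exact: subset_closure.
have [U [phi [chart [u Uu uz]]]] := surfS (test_projection_sub Pz).
have [oU _ _ _ hU] := chart.
have [V oV phiU] := hU U oU (@subset_refl _ U).
have mPV := measurable_open_layer oV mP.
apply: (@lt_le_trans _ _ (sqr_int f (test_projection `&` V))).
  apply: (@local_sqr_int_gt0 _ S N a mu surfS normalN a_gt0 volume K f test U phi _ chart
    _ _ mPV u z.2) => //.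
  - by move=> y [Py Vy]; rewrite phiU; split => //; exact: test_projection_sub.
  - by move=> y [Py _]; exact: test_projection_sub.
  - move=> u' t Uu' ft; split.
      by exists (phi u', t) => //; exact: subset_closure.
    by have : (phi @` U) (phi u') by [exists u']; rewrite phiU => -[].
  - by rewrite uz -surjective_pairing.
apply: ge0_subset_integral => //.
- apply/measurable_EFinP.
  apply: (measurable_sqr_chart_continuous surfS (chart_continuous_test test)).
  exact: test_projection_sub.
- by move=> y _; rewrite lee_fin sqr_ge0.
- by move=> y [[? _] ?].
Qed.

Lemma rayleigh_ge (c1 c2 : R) : 0 < c2 -> fiber_bound c1 c2 test_projection ->
  ((c1 / c2)%:E <= rayleigh S N a mu f)%E.
Proof.
move=> c20 [ineq fin]; rewrite /rayleigh integral_layer_sqr.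
have gt0 := test_sqr_int_gt0.
have {}ineq := le_trans ineq (lee_wpmul2l (ltW (_ : 0 < c2%:E)%E) integral_layer_grad).
have {}ineq := ineq c20.
have [r rE] : exists r, sqr_int f test_projection = r%:E.
  by exists (fine (sqr_int f test_projection)); rewrite fineK// gt0_fin_numE.
rewrite rE in gt0 ineq *; rewrite lte_fin in gt0.
rewrite inver gt_eqF// lee_pdivlMr// [c1 / c2]mulrC EFinM -muleA.
by rewrite lee_pdivrMl.
Qed.

End layer_bounds.

Section away_from_compact.
Context {R : realType}.
Local Notation BX := (g_sigma_algebraType (@open ('rV[R]_3 * R)%type)).
Variables (S : set 'rV[R]_3) (N : 'rV[R]_3 -> 'rV[R]_3) (a : R).
Variable mu : {measure set BX -> \bar R}.
Hypotheses (surfS : embedded_surface S) (normalN : unit_normal_field S N).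
Hypotheses (a_gt0 : 0 < a) (volume : layer_volume S N a mu).
Hypothesis embed : layer_embedding S N a.

Lemma fiber_bound_near (d : R) (C : set 'rV[R]_3) K f (x : 'rV[R]_3) :
  0 < d -> d <= 1 -> test_function S a K f -> compact C ->
  (forall U phi, local_param S U phi -> forall u, U u -> ~ C (phi u) ->
     second_form_norm N phi u < d / (3 * a)) ->
  S x -> ~ C x ->
  exists V, [/\ open V, V x & forall B, B `<=` S `&` V ->
    measurable (B `*` `[- a, a]%classic : set BX) ->
    fiber_bound a mu f ((1 - d) * (pi / (2 * a)) ^+ 2) (1 + d) B].
Proof.
move=> d0 d1 test cC CB Sx nCx.
have [U0 [phi [chart0 [u0 Uu0 ux]]]] := surfS Sx.
have [oU0 sphi _ _ hU0] := chart0.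
pose w u := layer_density N phi (u, 0).
have wc : {for u0, continuous w}.
  have c1 : (fun u : R * R => (u, 0 : R)) u @[u --> u0] --> (u0, 0 : R).
    have cu : id u @[u --> u0] --> u0 by exact: cvg_id.
    have ct : cst (0 : R) u @[u --> u0] --> (0 : R) by exact: cvg_cst.
    exact: (cvg_pair cu ct).
  exact: cvg_comp c1 (@layer_density_continuous _ _ _ _ _ chart0 normalN (u0, 0) Uu0).
have nU0 : nbhs u0 U0 by exact: open_nbhs_nbhs.
have nC : nbhs u0 (phi @^-1` (~` C)).
  apply: (smooth_on_continuous sphi Uu0); apply: open_nbhs_nbhs; split.
    by apply: closed_openC; apply: compact_closed => //; exact: norm_hausdorff.
  by rewrite /= ux.
have nw : nbhs u0 [set u | w u < w u0 + 1].
  have nr : nbhs (w u0) [set s | s < w u0 + 1].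
    by apply: open_nbhs_nbhs; split; [exact: open_lt|rewrite /= ltrDl].
  exact: (wc _ nr).
have nP : nbhs u0 (U0 `&` (phi @^-1` (~` C) `&` [set u | w u < w u0 + 1])).
  by apply: filterI => //; exact: filterI.
have [r /= r0 rP] := (nbhs_ballP _ _).1 nP.
pose U := ball u0 r.
have oU : open U by exact: ball_open.
have UU0 : U `<=` U0 by move=> u /rP[].
have chart := local_param_sub chart0 oU UU0.
have [V oV phiU] := hU0 U oU UU0.
have Uu0' : U u0 by exact: ballxx.
have wd u t : U u -> `|t| <= a ->
    `|layer_density N phi (u, t) - layer_density N phi (u, 0)| <=
      d * layer_density N phi (u, 0).
  move=> Uu ta; have [_ [nCu _]] := rP _ Uu.
  have Be := ltW (CB U phi chart u Uu nCu).
  apply: (le_trans (layer_density_bounds chart normalN a_gt0 embed Uu Be ta)).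
  apply: ler_wpM2r; first exact: sqrtr_ge0.
  have -> : a * (d / (3 * a)) = d / 3 by field; rewrite gt_eqF.
  nra.
exists V; split => //.
  by have : (phi @` U) x by [exists u0]; rewrite phiU => -[].
move=> B BSV mB.
have BU : B `<=` phi @` U by rewrite phiU.
have BS : B `<=` S by move=> y /BSV[].
have [M M0 fM] := test_bounded surfS test.
split.
  exact: (local_fiber_bound surfS normalN a_gt0 volume test chart BU BS mB (ltW d0) d1 wd).
apply: (@local_sqr_int_lty _ S N a mu surfS normalN a_gt0 volume K f test U phi B chart BU BS mB
  M (2 * (w u0 + 1)) r u0) => //.
  by rewrite mulr_ge0// addr_ge0// sqrtr_ge0.
move=> u t Uu ta; have := wd u t Uu ta; have [_ [_ /= wu]] := rP _ Uu.
rewrite ler_distl => /andP[_] wt; apply: (le_trans wt).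
rewrite -/(w u); have w0 : 0 <= w u by exact: sqrtr_ge0.
have dw : d * w u <= w u by rewrite ler_piMl.
by move: (w u) (w u0) wu dw => p q {wt w0}; lra.
Qed.

Lemma rayleigh_away_from_compact (d : R) (C : set 'rV[R]_3) f :
  0 < d -> d <= 1 -> compact C ->
  (forall U phi, local_param S U phi -> forall u, U u -> ~ C (phi u) ->
     second_form_norm N phi u < d / (3 * a)) ->
  test_function S a (C `*` `[- a, a]%classic) f ->
  (((1 - d) * (pi / (2 * a)) ^+ 2 / (1 + d))%:E <= rayleigh S N a mu f)%E.
Proof.
move=> d0 d1 cC CB test.
pose P := test_projection f.
have PC x : P x -> ~ C x.
  have [_ _ sub _] := test; move=> [z /sub[[Sz Iz] nz] <-] Cz; apply: nz; split => //=.
  by move: Iz; rewrite /= !in_itv /= => /andP[/ltW -> /ltW ->].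
have PS : P `<=` S by exact: test_projection_sub test.
have c10 : 0 <= (1 - d) * (pi / (2 * a)) ^+ 2 by rewrite mulr_ge0 ?sqr_ge0// subr_ge0.
have c20 : 0 < 1 + d by rewrite addr_gt0.
apply: (rayleigh_ge surfS normalN a_gt0 volume embed test c20).
have /choice[V VP] : forall x, exists V : set 'rV[R]_3, P x ->
    [/\ open V, V x & forall B, B `<=` S `&` V ->
      measurable (B `*` `[- a, a]%classic : set BX) ->
      fiber_bound a mu f ((1 - d) * (pi / (2 * a)) ^+ 2) (1 + d) B].
  move=> x; have [Px|nPx] := pselect (P x); last by exists set0.
  have [V HV] := fiber_bound_near d0 d1 test cC CB (PS _ Px) (PC _ Px).
  by exists V.
have cP : compact P by exact: compact_test_projection test.
have : cover_compact P by rewrite -compact_cover.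
move=> /(_ _ P V)[|x Px|D DP PD].
- by move=> x /VP[].
- by exists x => //; have [] := VP x Px.
apply: (@fiber_bound_cover _ S a mu surfS _ f test _ _ V (finmap.enum_fset D)) => //.
- exact: ltW.
- move=> x xD; have [|oV _ HV] := VP x; last by split.
  by have := DP x xD; rewrite inE.
- exact: measurable_compact_layer.
Qed.

End away_from_compact.

Theorem lemma2p1 (R : realType) (S : set 'rV[R]_3) (N : 'rV[R]_3 -> 'rV[R]_3)
    (a : R)
    (mu : {measure set (g_sigma_algebraType (@open ('rV[R]_3 * R)%type))
           -> \bar R})
    (surfS : embedded_surface S)
    (orientS : orientable S)
    (completeS : complete_surface S)
    (noncompactS : ~ compact S)
    (normalN : unit_normal_field S N)
    (not_tot_geod : ~ totally_geodesic S N)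
    (B_vanishes : second_form_vanishes_at_infinity S N)
    (a_gt0 : 0 < a)
    (embed : layer_embedding S N a)
    (volume : layer_volume S N a mu) :
  (((pi : R) ^+ 2 / (4 * a ^+ 2))%:E <= sigma_ess S N a mu)%E.

Proof.
set k2 := pi ^+ 2 / (4 * a ^+ 2).
have k20 : 0 <= k2 by apply: divr_ge0; [exact: sqr_ge0|apply: mulr_ge0 => //; exact: sqr_ge0].
have k2E : (pi / (2 * a)) ^+ 2 = k2.
  by rewrite /k2 expr_div_n exprMn -natrX.
apply/lee_addgt0Pr => e e0.
pose d := e / (2 * k2 + e).
have ke0 : 0 < 2 * k2 + e by rewrite ltr_wpDl// mulr_ge0.
have d0 : 0 < d by rewrite divr_gt0.
have d1 : d <= 1 by rewrite ler_pdivrMr// mul1r lerDr mulr_ge0.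
have eps0 : 0 < d / (3 * a) by rewrite divr_gt0// mulr_gt0.
have [C [cC CS CB]] := B_vanishes _ eps0.
have sub_layer : C `*` `[- a, a]%classic `<=` layer S a.
  by move=> z [Cz Iz]; split => //; exact: CS.
have cK : compact (C `*` `[- a, a]%classic).
  by apply: compact_setX => //; exact: segment_compact.
apply: (@le_trans _ _ (((1 - d) * k2 / (1 + d))%:E + e%:E)%E).
  rewrite -EFinD lee_fin -lerBlDr.
  have d1' : 0 < 1 + d by rewrite addr_gt0.
  rewrite ler_pdivlMr//.
  have : 2 * k2 * d <= e.
    rewrite /d mulrA ler_pdivrMr// mulrDr [e * _]mulrC ler_wpDr//.
    by rewrite -expr2 sqr_ge0.
  nra.
apply: leeD => //; rewrite /sigma_ess.
apply: (@le_trans _ _ (ereal_inf [set rayleigh S N a mu f |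
    f in test_function S a (C `*` `[- a, a]%classic)])).
  apply: le_ereal_inf_tmp => _ [f test <-]; rewrite -k2E.
  exact: (rayleigh_away_from_compact surfS normalN a_gt0 volume embed d0 d1 cC CB test).
by apply: ereal_sup_ubound; exists (C `*` `[- a, a]%classic).
Qed.
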